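(* Let $y_d\in L^2(\omega_o)$ and assume the pre-dual Slater condition: there exist $\tilde h\in\operatorname{dom}{}^*S$ and $\varepsilon>0$ such that $({}^*S\tilde h)(x)\ge\varepsilon$ for all $x\in\overline\omega_c$. Define $\Phi:L^2(\omega_o)\times C(\overline\omega_c)\to\mathbb R\cup\{+\infty\}$ by $$\Phi(h,v)=\tfrac12\|h+y_d\|_{L^2(\omega_o)}^2-\tfrac12\|y_d\|_{L^2(\omega_o)}^2+\delta_{C(\overline\omega_c)^+}({}^*Sh-v)+\delta_{\operatorname{dom}{}^*S}(h)$$ (with value $+\infty$ if $h\notin\operatorname{dom}{}^*S$), and let $\Phi^*:L^2(\omega_o)\times\mathcal M(\overline\omega_c)\to\mathbb R\cup\{+\infty\}$ be its Fenchel conjugate with respect to $(h,v)$. Then $$\inf_{h\in L^2(\omega_o)}\Phi(h,0)=\sup_{v^*\in\mathcal M(\overline\omega_c)}-\Phi^*(0,v^* ).$$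
   Context: Setting. $\Omega\subset\mathbb R^d$ is a bounded domain (open, connected) with Lipschitz boundary. On $H^1(\Omega)\times H^1(\Omega)$ let $$a(y,p)=\int_\Omega\Big[\sum_{i,j=1}^d a_{ij}y_{x_i}p_{x_j}+c\,y\,p\Big]dx+\int_{\partial\Omega}r\,y\,p\,ds,$$ where $a_{ij}=a_{ji}\in L^\infty(\Omega)$, $\sum a_{ij}(x)\xi_i\xi_j\ge a_0|\xi|^2$ for some $a_0>0$, all $\xi\in\mathbb R^d$ and a.a. $x\in\Omega$, $0\le c\in L^\infty(\Omega)$, $0\le r\in L^\infty(\partial\Omega)$, and $c,r$ are not both identically $0$ (so $a$ is coercive on $H^1(\Omega)$). Fix $q>d$ with dual index $q'$, $1/q+1/q'=1$, $q'\le 2$. Operator $A$. Let $\operatorname{dom}{}^*A:=\{p\in H^1(\Omega):\exists c_p\in\mathbb R,\ a(y,p)\le c_p\|y\|_{W^{1,q'}(\Omega)}\ \forall y\in H^1(\Omega)\}$ and for $p\in\operatorname{dom}{}^*A$ let ${}^*A p\in W^{1,q'}(\Omega)^*$ be the unique continuous extension of $y\mapsto a(y,p)$ from $H^1(\Omega)$ to $W^{1,q'}(\Omega)$. It is a standing assumption that $\operatorname{dom}{}^*A\subset C(\overline\Omega)$; then ${}^*A:C(\overline\Omega)\supset\operatorname{dom}{}^*A\to W^{1,q'}(\Omega)^*$ is closed, densely defined, bijective with continuous inverse. Operator $B$. $\overline\omega_c\subset\overline\Omega$ is compact, and ${}^*B:C(\overline\Omega)\to C(\overline\omega_c)$ is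 restriction. $\mathcal M(\overline\omega_c)=C(\overline\omega_c)^*$ is the space of Radon measures. Operator $E$. $\omega_o\subset\overline\Omega$ carries a suitable measure and $E:W^{1,q'}(\Omega)\supset\operatorname{dom}E\to L^2(\omega_o)$ is a closed, possibly unbounded, linear operator whose domain is dense and contains $H^1(\Omega)$. ${}^*E:=E^*:L^2(\omega_o)\supset\operatorname{dom}{}^*E\to W^{1,q'}(\Omega)^*$ (closed, densely defined). Operator ${}^*S$. ${}^*S:={}^*B\,({}^*A)^{-1}\,{}^*E:L^2(\omega_o)\supset\operatorname{dom}{}^*S:=\operatorname{dom}{}^*E\to C(\overline\omega_c)$, a densely defined linear operator. $C(\overline\omega_c)^+$ is the cone of non-negative continuous functions; $\delta_C$ is the indicator function of a set $C$ ($0$ on $C$, $+\infty$ elsewhere). The Fenchel conjugate of $\mathcal F:W\to\mathbb R\cup\{\infty\}$ is $\mathcal F^*(w^* )=\sup_{w\in W}\langle w^*,w\rangle-\mathcal F(w)$. *)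

(* Defs.v *)
From HB Require Import structures.
From mathcomp Require Import all_boot all_order all_algebra.
From mathcomp Require Import all_classical all_reals all_analysis.

Set Implicit Arguments.
Unset Strict Implicit.
Unset Printing Implicit Defensive.
Import Order.TTheory GRing.Theory Num.Theory.
Import numFieldNormedType.Exports.

Local Open Scope classical_set_scope.
Local Open Scope ring_scope.

(** * Seminormed function spaces and unbounded operators

    Spaces such as L^2 or W^{1,p} are handled through representatives: a space
    is a set of vectors of an ambient [lmodType] with a real-valued seminorm,
    and two representatives are identified when their difference has
    seminorm 0. The seminorm is only meaningful on the carrier. *)

Record snspace (R : realType) (V : lmodType R) := SNSpace {
  carr : set V ;
  nrm : V -> R }.

(** Only the values of a functional on [X] are meaningful. *)
Definition dual (R : realType) (V : lmodType R) (X : snspace V) :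
    set (V -> R) :=
  [set f | (forall (a : R) u v, carr X u -> carr X v ->
              f (a *: u + v) = a * f u + f v) /\
           exists C : R, forall u, carr X u -> `|f u| <= C * nrm X u].

(** An operator with domain is given by its graph. *)

Definition dom_graph (A B : Type) (G : set (A * B)) : set A :=
  [set a | exists b, G (a, b)].

Definition app_graph (A B : Type) (G : set (A * B)) (a : A) : set B :=
  [set b | G (a, b)].

Definition inv_graph (A B : Type) (G : set (A * B)) : set (B * A) :=
  [set ba | G (ba.2, ba.1)].

Definition comp_graph (A B C : Type) (G : set (B * C)) (F : set (A * B)) :
    set (A * C) :=
  [set ac | exists b, F (ac.1, b) /\ G (b, ac.2)].

Section operators.
Variables (R : realType) (V W : lmodType R) (X : snspace V) (Y : snspace W).
Implicit Type G : set (V * W).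

Definition linear_operator G :=
  [/\ G `<=` [set uz | carr X uz.1 /\ carr Y uz.2],
      G 0,
      (forall (a : R) uz uz', G uz -> G uz' -> G (a *: uz + uz')) &
      (forall uz, G uz -> nrm X uz.1 = 0 -> nrm Y uz.2 = 0)].

Definition closed_operator G :=
  forall (uz : nat -> V * W) (u : V) (z : W), (forall n, G (uz n)) ->
    carr X u -> carr Y z ->
    nrm X ((uz n).1 - u) @[n --> \oo] --> (0 : R) ->
    nrm Y ((uz n).2 - z) @[n --> \oo] --> (0 : R) ->
    G (u, z).

Definition densely_defined G :=
  forall u, carr X u -> forall e : R, 0 < e ->
    exists2 v, dom_graph G v & nrm X (u - v) < e.

(** The adjoint of [G] when the dual of [Y] is represented by [Y'] through the
    pairing [pair]. *)
Definition adjoint_graph (W' : Type) (Y' : set W') (pair : W -> W' -> R) G :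
    set (W' * (V -> R)) :=
  [set hf | [/\ Y' hf.1, dual X hf.2 &
                forall u z, G (u, z) -> hf.2 u = pair z hf.1]].

End operators.

Section convex_analysis.
Variable R : realType.
Local Open Scope ereal_scope.

Definition indicator (W : Type) (C : set W) (w : W) : \bar R :=
  if `[< C w >] then 0 else +oo.

Definition fenchel_conj (W W' : Type) (X : set W) (pair : W' -> W -> R)
    (F : W -> \bar R) (w' : W') : \bar R :=
  ereal_sup [set (pair w' w)%:E - F w | w in X].

End convex_analysis.
Arguments indicator {R W} C w.

(** * Lebesgue measure and surface measure *)

Definition enorm (R : realType) d (x : 'rV[R]_d) : R :=
  Num.sqrt (\sum_(i < d) x ord0 i ^+ 2).

Section cover_outer_measure.
Local Open Scope ereal_scope.
Variables (R : realType) (T : pointedType).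

Definition cover_ext (z : set T -> \bar R) (A : set T) : \bar R :=
  ereal_inf [set \sum_(k <oo) z (F k) |
    F in [set F : nat -> set T | A `<=` \bigcup_k F k]].

(** [T] with all its subsets as measurable sets, so that [mu_ext] covers by
    arbitrary sets. *)
Definition all_measurable : Type := T.

HB.instance Definition _ := Pointed.on all_measurable.
HB.instance Definition _ := @isMeasurable.Build default_measure_display
  all_measurable [set: set all_measurable] I (fun _ _ => I) (fun _ _ => I).

Variable z : set T -> \bar R.
Hypotheses (z0 : z set0 = 0) (z_ge0 : forall A, 0 <= z A).

Lemma cover_extE : cover_ext z = mu_ext (z : set all_measurable -> \bar R).
Proof.
apply/funext => A; rewrite /cover_ext /mu_ext; congr ereal_inf.
apply/seteqP; split => x /=; first by move=> [F AF <-]; exists F.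
by move=> [F [_ AF] <-]; exists F.
Qed.

Lemma cover_ext0 : cover_ext z set0 = 0.
Proof. by rewrite cover_extE; exact: mu_ext0. Qed.

Lemma cover_ext_ge0 A : 0 <= cover_ext z A.
Proof. by rewrite cover_extE; exact: mu_ext_ge0. Qed.

Lemma le_cover_ext : {homo cover_ext z : A B / A `<=` B >-> A <= B}.
Proof.
move=> A B AB; apply: ereal_inf_le_tmp => _ [F BF <-].
by exists F => //; exact: subset_trans AB BF.
Qed.

Lemma cover_ext_sigma_subadditive : sigma_subadditive (cover_ext z).
Proof.
rewrite cover_extE.
exact: (@mu_ext_sigma_subadditive _ all_measurable R z z_ge0).
Qed.

End cover_outer_measure.

Section lebesgue_rV.
Variables (R : realType) (d : nat).
Local Open Scope ereal_scope.

Definition box (a b : 'rV[R]_d) : set 'rV[R]_d :=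
  [set x | forall i, (a ord0 i <= x ord0 i <= b ord0 i)%R].

(** Volume of the smallest box that contains [A]; with it, covers by arbitrary
    sets amount to covers by boxes. *)
Definition box_content (A : set 'rV[R]_d) : \bar R :=
  if `[< A = set0 >] then 0 else
  ereal_inf [set (\prod_(i < d) (ab.2 ord0 i - ab.1 ord0 i)%R)%:E |
    ab in [set ab : 'rV[R]_d * 'rV[R]_d | A `<=` box ab.1 ab.2]].

Lemma box_content0 : box_content set0 = 0.
Proof. by rewrite /box_content; case: asboolP. Qed.

Lemma box_content_ge0 A : 0 <= box_content A.
Proof.
rewrite /box_content; case: asboolP => // /eqP/set0P[x Ax].
apply: le_ereal_inf_tmp => _ [[a b] /= Aab <-]; rewrite lee_fin.
apply: prodr_ge0 => i _; have /andP[ax xb] := Aab _ Ax i.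
by rewrite subr_ge0 (le_trans ax xb).
Qed.

Definition lebesgue_outer (A : set 'rV[R]_d) : \bar R :=
  cover_ext box_content A.

HB.instance Definition _ := isOuterMeasure.Build R 'rV[R]_d lebesgue_outer
  (cover_ext0 box_content0 box_content_ge0)
  (cover_ext_ge0 box_content_ge0)
  (@le_cover_ext _ _ box_content)
  (cover_ext_sigma_subadditive box_content_ge0).

Definition lebesgue_om : {outer_measure set 'rV[R]_d -> \bar R} := lebesgue_outer.

Definition lebesgue_rV : {measure set (caratheodory_type lebesgue_om) -> \bar R} :=
  [the {measure set (caratheodory_type lebesgue_om) -> \bar R} of
    lebesgue_om : set (caratheodory_type lebesgue_om) -> \bar R].

End lebesgue_rV.

Section hausdorff_rV.
Variables (R : realType) (d s : nat).
Local Open Scope ereal_scope.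

Definition ediam (A : set 'rV[R]_d) : R :=
  sup [set enorm (xy.1 - xy.2) | xy in A `*` A].

(** The volume of the unit ball of R^s normalizes the Hausdorff measure so that
    it is the usual surface measure on [s]-dimensional surfaces. *)
Definition ball_volume : R :=
  fine (lebesgue_rV R s [set x | (enorm x <= 1)%R]).

Definition hausdorff_content (delta : R) (A : set 'rV[R]_d) : \bar R :=
  if `[< A = set0 >] then 0 else
  if `[< forall x y, A x -> A y -> (enorm (x - y) <= delta)%R >]
  then (ball_volume * (ediam A / 2) ^+ s)%:E else +oo.

Lemma hausdorff_content0 delta : hausdorff_content delta set0 = 0.
Proof. by rewrite /hausdorff_content; case: asboolP. Qed.

Lemma hausdorff_content_ge0 delta A : 0 <= hausdorff_content delta A.
Proof.
rewrite /hausdorff_content; case: asboolP => // _; case: asboolP => // _.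
rewrite lee_fin mulr_ge0 ?fine_ge0// exprn_ge0// divr_ge0// /ediam.
set B := (X in sup X); have [hB|/sup_out->//] := pselect (has_sup B).
have [z Bz] := hB.1; apply: (le_trans _ (ub_le_sup hB.2 Bz)).
by have [xy _ <-] := Bz; exact: sqrtr_ge0.
Qed.

Definition hausdorff_outer (A : set 'rV[R]_d) : \bar R :=
  ereal_sup [set cover_ext (hausdorff_content delta) A |
    delta in [set delta : R | (0 < delta)%R]].

Let ext_le delta A : (0 < delta)%R ->
  cover_ext (hausdorff_content delta) A <= hausdorff_outer A.
Proof. by move=> d0; apply: ereal_sup_ubound; exists delta. Qed.

Let outer0 : hausdorff_outer set0 = 0.
Proof.
apply/eqP; rewrite eq_le; apply/andP; split.
  apply: ge_ereal_sup => _ [delta _ <-].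
  by rewrite cover_ext0//; [exact: hausdorff_content0 |
    exact: hausdorff_content_ge0].
apply: (le_trans _ (ext_le _ ltr01)).
by apply: cover_ext_ge0; exact: hausdorff_content_ge0.
Qed.

Let outer_ge0 A : 0 <= hausdorff_outer A.
Proof.
apply: (le_trans _ (ext_le _ ltr01)).
by apply: cover_ext_ge0; exact: hausdorff_content_ge0.
Qed.

Let outer_le : {homo hausdorff_outer : A B / A `<=` B >-> A <= B}.
Proof.
move=> A B AB; apply: ge_ereal_sup => _ [delta d0 <-].
by apply: (le_trans _ (ext_le _ d0)); exact: le_cover_ext.
Qed.

Let outer_sigma_subadditive : sigma_subadditive hausdorff_outer.
Proof.
move=> F; apply: ge_ereal_sup => _ [delta d0 <-].
apply: le_trans.
  by apply: cover_ext_sigma_subadditive; exact: hausdorff_content_ge0.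
apply: lee_nneseries => n *; last exact: ext_le.
by apply: cover_ext_ge0; exact: hausdorff_content_ge0.
Qed.

HB.instance Definition _ := isOuterMeasure.Build R 'rV[R]_d hausdorff_outer
  outer0 outer_ge0 outer_le outer_sigma_subadditive.

Definition hausdorff_om : {outer_measure set 'rV[R]_d -> \bar R} := hausdorff_outer.

Definition hausdorff_rV : {measure set (caratheodory_type hausdorff_om) -> \bar R} :=
  [the {measure set (caratheodory_type hausdorff_om) -> \bar R} of
    hausdorff_om : set (caratheodory_type hausdorff_om) -> \bar R].

End hausdorff_rV.

Notation borel_rV R d := (g_sigma_algebraType (@open 'rV[R]_d)).

(** * Function spaces *)

(** L^p(D) for a measurable set [D]; [p] may be [+oo]. *)
Definition Lspace_on (R : realType) disp (T : measurableType disp)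
    (mu : {measure set T -> \bar R}) (D : set T) (p : \bar R) :
    snspace (T -> R) :=
  SNSpace [set f | f \_ D \in Lfun mu p]
          (fun f => fine ('N[mu]_p[EFin \o (f \_ D)])).

Definition cont_space (R : realType) (T : topologicalType) (K : set T) :
    snspace (T -> R) :=
  SNSpace [set f : T -> R | {within K, continuous f}]
          (fun f => sup [set `|f x| | x in K]).

Definition nonneg_cone (R : realType) (T : topologicalType) (K : set T) :
    set (T -> R) :=
  [set f | carr (cont_space R K) f /\ forall x, K x -> 0 <= f x].

Section sobolev.
Variables (R : realType) (d : nat) (Om : set 'rV[R]_d).

Definition bdry : set 'rV[R]_d := closure Om `\` Om°.

Definition partial (i : 'I_d) (f : 'rV[R]_d -> R) : 'rV[R]_d -> R :=
  'D_(delta_mx ord0 i) f.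

Definition smooth (f : 'rV[R]_d -> R) : Prop :=
  forall s : seq 'I_d, continuous (foldr partial f s) /\
    forall i x, derivable (foldr partial f s) x (delta_mx ord0 i).

Definition test_fun (f : 'rV[R]_d -> R) : Prop :=
  smooth f /\
  exists K, [/\ compact K, K `<=` Om & forall x, ~ K x -> f x = 0].

Definition weak_partial (i : 'I_d) (u g : 'rV[R]_d -> R) : Prop :=
  forall phi, test_fun phi ->
    \int[lebesgue_rV R d]_(x in Om) (u x * partial i phi x) =
    - \int[lebesgue_rV R d]_(x in Om) (g x * phi x).

(** A Sobolev function is represented by a pair (u, Du) of representatives of
    the function and of its weak gradient; the latter is determined almost
    everywhere by u. *)
Definition sobfun : lmodType R :=
  (('rV[R]_d -> R) * ('I_d -> 'rV[R]_d -> R))%type.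

Definition Lp_Om (p : \bar R) : snspace ('rV[R]_d -> R) :=
  Lspace_on (lebesgue_rV R d) Om p.

Definition Lp_bdry (p : \bar R) : snspace ('rV[R]_d -> R) :=
  Lspace_on (hausdorff_rV R d d.-1) bdry p.

Definition sobolev (p : R) : snspace sobfun :=
  @SNSpace R sobfun
    [set u | carr (Lp_Om p%:E) u.1 /\
             forall i, carr (Lp_Om p%:E) (u.2 i) /\ weak_partial i u.1 (u.2 i)]
    (fun u => (nrm (Lp_Om p%:E) u.1 `^ p +
               \sum_(i < d) nrm (Lp_Om p%:E) (u.2 i) `^ p) `^ p^-1).

(** The trace operator, as the continuous extension to H^1(Om) of the
    restriction of smooth functions to the boundary: [g] is the trace of [u].
    For a bounded Lipschitz domain the trace exists and is unique as an element
    of L^2 of the boundary. *)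
Definition trace_of (u : sobfun) (g : 'rV[R]_d -> R) : Prop :=
  [/\ carr (sobolev 2) u, carr (Lp_bdry 2%:E) g &
    exists phi : nat -> 'rV[R]_d -> R,
      [/\ forall n, [/\ smooth (phi n),
            carr (sobolev 2) (phi n, fun i => partial i (phi n)) &
            carr (Lp_bdry 2%:E) (phi n)],
          nrm (sobolev 2) ((phi n, fun i => partial i (phi n)) - u)
            @[n --> \oo] --> (0 : R) &
          nrm (Lp_bdry 2%:E) (phi n - g) @[n --> \oo] --> (0 : R)]].

(** Near each boundary point, in suitable orthonormal coordinates, [Om] lies on
    one side of the graph of a Lipschitz function of [d.-1] variables. *)
Definition lipschitz_boundary : Prop :=
  forall x0, bdry x0 ->
  exists (rho L : R) (k : 'I_d) (Q : 'M[R]_d) (gamma : 'rV[R]_d.-1 -> R),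
  [/\ 0 < rho, Q *m Q^T = 1%:M,
      (forall s t, `|gamma s - gamma t| <= L * enorm (s - t)) &
      forall x, enorm (x - x0) < rho ->
        Om x <-> gamma (col' k (x *m Q)) < (x *m Q) ord0 k].

Definition bounded_lipschitz_domain : Prop :=
  [/\ open Om, connected Om, Om !=set0, bounded_set Om & lipschitz_boundary].

End sobolev.

(** * The operators A, B, E and S *)

Section elliptic.
Variables (R : realType) (d : nat) (Om : set 'rV[R]_d).
Variables (aij : 'I_d -> 'I_d -> 'rV[R]_d -> R) (c r : 'rV[R]_d -> R).

Local Notation leb := (lebesgue_rV R d).
Local Notation surf := (hausdorff_rV R d d.-1).
Local Notation H1 := (sobolev Om 2).

Definition elliptic_coefficients (a0 : R) : Prop :=
  [/\ forall i j, carr (Lp_Om Om +oo) (aij i j),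
      {ae leb, forall x, Om x -> forall i j, aij i j x = aij j i x},
      0 < a0 &
      {ae leb, forall x, Om x -> forall xi : 'rV[R]_d,
        a0 * enorm xi ^+ 2 <=
        \sum_(i < d) \sum_(j < d) aij i j x * xi ord0 i * xi ord0 j}].

Definition lower_order_coefficients : Prop :=
  [/\ carr (Lp_Om Om +oo) c, {ae leb, forall x, Om x -> 0 <= c x},
      carr (Lp_bdry Om +oo) r, {ae surf, forall x, bdry Om x -> 0 <= r x} &
      ~ ({ae leb, forall x, Om x -> c x = 0} /\
         {ae surf, forall x, bdry Om x -> r x = 0})].

(** a(y, p); [gy] and [gp] are the traces of [y] and [p]. *)
Definition aform (y : sobfun R d) (gy : 'rV[R]_d -> R)
    (p : sobfun R d) (gp : 'rV[R]_d -> R) : R :=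
  \int[leb]_(x in Om)
    (\sum_(i < d) \sum_(j < d) aij i j x * y.2 i x * p.2 j x
     + c x * y.1 x * p.1 x)
  + \int[surf]_(x in bdry Om) (r x * gy x * gp x).

Variable q' : R.
Local Notation W := (sobolev Om q').

Definition dom_A : set (sobfun R d) :=
  [set p | carr H1 p /\ exists gp, trace_of Om p gp /\
    exists cp : R, forall y gy, carr H1 y -> trace_of Om y gy ->
      aform y gy p gp <= cp * nrm W y].

(** [p] has a continuous representative on the closure of [Om]. *)
Definition cont_repr (p : sobfun R d) (phi : 'rV[R]_d -> R) : Prop :=
  carr (cont_space R (closure Om)) phi /\
  {ae leb, forall x, Om x -> phi x = p.1 x}.

(** *A, as an operator from C(closure Om) to the dual of W^{1,q'}(Om). *)
Definition A_graph : set (('rV[R]_d -> R) * (sobfun R d -> R)) :=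
  [set pf | exists p gp,
    [/\ dom_A p, cont_repr p pf.1, dual W pf.2, trace_of Om p gp &
        forall y gy, carr H1 y -> trace_of Om y gy ->
          pf.2 y = aform y gy p gp]].

(** *B, the restriction from C(closure Om) to C(omc). *)
Definition B_graph (omc : set 'rV[R]_d) :
    set (('rV[R]_d -> R) * ('rV[R]_d -> R)) :=
  [set pw | [/\ carr (cont_space R (closure Om)) pw.1,
                carr (cont_space R omc) pw.2 &
                forall x, omc x -> pw.2 x = pw.1 x]].

Variables (omc : set 'rV[R]_d) (omo : set 'rV[R]_d).
Variable muo : {measure set (borel_rV R d) -> \bar R}.

Definition L2_obs : snspace ('rV[R]_d -> R) := Lspace_on muo omo 2%:E.

Definition inner_obs (g h : 'rV[R]_d -> R) : R :=
  \int[muo]_(x in omo) (g x * h x).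

Variable E : set (sobfun R d * ('rV[R]_d -> R)).

Definition observation_operator : Prop :=
  [/\ linear_operator W L2_obs E, closed_operator W L2_obs E,
      densely_defined W E & carr H1 `<=` dom_graph E].

Definition E_adj : set (('rV[R]_d -> R) * (sobfun R d -> R)) :=
  adjoint_graph W (carr L2_obs) inner_obs E.

Definition S_graph : set (('rV[R]_d -> R) * ('rV[R]_d -> R)) :=
  comp_graph (B_graph omc) (comp_graph (inv_graph A_graph) E_adj).

Definition dom_S : set ('rV[R]_d -> R) := dom_graph E_adj.

Variable yd : 'rV[R]_d -> R.

(** [app_graph S_graph h] holds the representatives of the function *S h in
    C(omc), and is empty outside of [dom_S]; the infimum is thus the value of
    the indicator function of the cone at *S h - v. *)
Definition Phi (hv : ('rV[R]_d -> R) * ('rV[R]_d -> R)) : \bar R :=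
  ((2^-1 * nrm L2_obs (hv.1 + yd) ^+ 2 - 2^-1 * nrm L2_obs yd ^+ 2)%R%:E
   + ereal_inf [set indicator (nonneg_cone omc) (w - hv.2)%R |
                w in app_graph S_graph hv.1]
   + indicator dom_S hv.1)%E.

(** M(omc) is the dual of C(omc). *)
Definition radon : set (('rV[R]_d -> R) -> R) := dual (cont_space R omc).

(** Conjugation with respect to both variables, L^2 being its own dual. *)
Definition Phi_conj
    (hv' : ('rV[R]_d -> R) * (('rV[R]_d -> R) -> R)) : \bar R :=
  fenchel_conj [set hv | carr L2_obs hv.1 /\ carr (cont_space R omc) hv.2]
    (fun hv' hv => inner_obs hv'.1 hv.1 + hv'.2 hv.2) Phi hv'.

End elliptic.

(* Main.v *)
Require Import Defs.
From mathcomp Require Import all_boot all_order all_algebra.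
From mathcomp Require Import all_classical all_reals all_analysis.
From mathcomp Require Import measurable_realfun ess_sup_inf ring lra.
Import Order.TTheory GRing.Theory Num.Theory.
Import numFieldNormedType.Exports.

Set Implicit Arguments.
Unset Strict Implicit.
Unset Printing Implicit Defensive.

Local Open Scope classical_set_scope.
Local Open Scope ring_scope.

(** Write [J h] for the quadratic part of [Phi (h, v)] and let the value function
    [nu v] be the infimum of [J h] over the pairs [(h, w)] in the graph of *S with
    [v <= w] on [omc]. Multiples of the Slater point dominate every continuous
    function, so [nu] is finite everywhere on C(omc) and bounded above on balls;
    it is convex because the graph of *S is a linear space. By Hahn-Banach some
    linear [f] satisfies [f v <= nu v - nu 0]; it is continuous because [nu] is
    bounded above on balls, and it attains the supremum on the dual side.

    That the graph of *S is linear rests on the linearity of weak derivatives,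
    traces and of the bilinear form, hence on the integrability of the products
    involved. For the test functions this needs the open sets to be Caratheodory
    measurable for [lebesgue_rV]: half-spaces are, because a half-space splits a
    box into two boxes. *)

(** * Linear structure of the function spaces *)

Lemma fct_scaleD (R : realType) (I : Type) (V : lmodType R) (a : R)
  (f g : I -> V) i : (a *: f + g) i = a *: f i + g i.
Proof. by []. Qed.

Lemma pair_scaleD2 (R : realType) (V W : lmodType R) (a : R)
  (u v : V * W) : (a *: u + v).2 = a *: u.2 + v.2.
Proof. by []. Qed.

Lemma pair_oppr2 (R : realType) (V W : lmodType R) (u : V * W) : (- u).2 = - u.2.
Proof. by []. Qed.

Lemma fct_oppr (R : realType) (I : Type) (V : lmodType R) (f : I -> V) i :
  (- f) i = - f i.
Proof. by []. Qed.

Lemma dual_scaleD (R : realType) (V : lmodType R) (X : snspace V) (a : R)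
  (f g : V -> R) : dual X f -> dual X g -> dual X (a *: f + g).
Proof.
move=> [lf [C fC]] [lg [D gD]]; split.
  move=> b u v Xu Xv; rewrite !fct_scaleD lf// lg//.
  by rewrite /GRing.scale /=; ring.
exists (`|a| * C + D) => u Xu; rewrite fct_scaleD.
apply: (le_trans (ler_normD _ _)); rewrite normrM mulrDl -mulrA lerD ?gD//.
by rewrite ler_wpM2l ?fC.
Qed.

Lemma cont_space_scaleD (R : realType) (T : topologicalType) (K : set T) (a : R)
  (f g : T -> R) : carr (cont_space R K) f -> carr (cont_space R K) g ->
  carr (cont_space R K) (a *: f + g).
Proof.
by move=> cf cg x; exact: (cvgD (cvgZ (cvg_cst a) (cf x)) (cg x)).
Qed.

(** * L^p seminorms and integrals over a subset *)

Section Lspace_on_theory.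
Context (R : realType) disp (T : measurableType disp).
Variables (mu : {measure set T -> \bar R}) (D : set T).
Implicit Types f g u v : T -> R.

Local Notation L p := (Lspace_on mu D p).

Lemma restrict_scaleD (a : R) u v : (a *: u + v) \_ D = a *: u \_ D + v \_ D.
Proof.
apply/funext => x; rewrite /patch /=.
by rewrite !fctE; case: ifPn => _ //; rewrite scaler0 addr0.
Qed.

Lemma restrict_mul u v : (fun x => u x * v x) \_ D = u \_ D \* v \_ D.
Proof. by apply/funext => x; rewrite /patch /=; case: ifPn => _; rewrite ?mulr0. Qed.

Lemma Lspace_scaleD (p : \bar R) (a : R) u v : (1 <= p)%E ->
  carr (L p) u -> carr (L p) v -> carr (L p) (a *: u + v).
Proof. by move=> p1 /= Lu Lv; rewrite restrict_scaleD; apply: (Lfun_submod_closed mu p1).2. Qed.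

Lemma Lspace0 (p : \bar R) : (1 <= p)%E -> carr (L p) 0.
Proof.
move=> p1 /=; rewrite (_ : _ \_ D = 0); first exact: (Lfun_submod_closed mu p1).1.
by apply/funext => x; rewrite /patch; case: ifP.
Qed.

Lemma Lspace_nrm_ge0 (p : \bar R) u : 0 <= nrm (L p) u.
Proof. by rewrite /= fine_ge0// Lnorm_ge0. Qed.

Lemma Lspace_nrmN (p : \bar R) u : nrm (L p) (- u) = nrm (L p) u.
Proof.
rewrite /= (_ : _ \o _ = \- (EFin \o u \_ D))%E ?oppe_Lnorm//.
by apply/funext => x; rewrite /patch /=; case: ifP => _; rewrite ?oppr0.
Qed.

Lemma Lspace_nrm_scaleD (p : \bar R) (a : R) u v : (1 <= p)%E ->
  carr (L p) u -> carr (L p) v ->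
  nrm (L p) (a *: u + v) <= `|a| * nrm (L p) u + nrm (L p) v.
Proof.
move=> p1 /= Lu Lv; rewrite restrict_scaleD.
pose u' : LfunType mu p1 := Lfun_Sub p1 Lu; pose v' : LfunType mu p1 := Lfun_Sub p1 Lv.
apply: (le_trans (ler_LnormD (a *: u') v')); rewrite lerD2r.
rewrite (_ : EFin \o _ = EFin \o (a \*: u'))// LnormZ fineM//.
by rewrite -finite_norm_fine.
Qed.

Lemma Lspace_nrmZ (p : \bar R) (a : R) u : (1 <= p)%E -> carr (L p) u ->
  nrm (L p) (a *: u) <= `|a| * nrm (L p) u.
Proof.
move=> p1 Lu; have := Lspace_nrm_scaleD a p1 Lu (Lspace0 p1).
rewrite addr0 (_ : nrm (L p) 0 = 0) ?addr0//.
rewrite /= (_ : _ \o _ = cst 0%E) ?Lnorm0//; first by rewrite gt_eqF// (lt_le_trans _ p1).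
by apply/funext => x; rewrite /patch /=; case: ifP.
Qed.

Lemma Lspace2_mul u v : carr (L 2%:E) u -> carr (L 2%:E) v ->
  carr (L 1%:E) (fun x => u x * v x).
Proof. by move=> /= Lu Lv; rewrite restrict_mul Lfun2_mul_Lfun1. Qed.

Lemma Lspacey_bounded u : carr (L +oo%E) u ->
  exists M : R, 0 <= M /\ {ae mu, forall x, `|(u \_ D) x| <= M}.
Proof.
move=> /= /[!inE] /andP[_]; rewrite inE /= /finite_norm unlock /Lnorm.
case: ifPn => mu0 supoo.
  have /ess_supr_bounded[M HM] : (ess_sup mu (fun x => `|(u \_ D) x|%:E) < +oo)%E by [].
  exists (Num.max 0 M); split; first by rewrite le_max lexx.
  by apply: filterS HM => x /= HM; rewrite le_max HM orbT.
(* Here the whole space has measure zero, so any bound holds almost everywhere. *)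
exists 0; split => //; exists setT; split => //.
by apply/eqP; rewrite eq_le measure_ge0 andbT leNgt.
Qed.

(** The Hölder case of exponents infinity and 1: with [M] an essential bound of [u], the product is
    dominated almost everywhere by [M] times the absolute value of [v]. *)
Lemma Lspacey_mul1 u v : carr (L +oo%E) u -> carr (L 1%:E) v ->
  carr (L 1%:E) (fun x => u x * v x).
Proof.
move=> Lu /Lfun1_integrable Lv; have [M [M0 uM]] := Lspacey_bounded Lu.
have mu_ : measurable_fun setT (u \_ D) by have /andP[/set_mem] := Lu.
have mv : measurable_fun setT (v \_ D).
  by have /integrableP[/measurable_EFinP] := Lv.
apply/Lfun1_integrable.
rewrite restrict_mul.
have LM : mu.-integrable setT (fun x => M%:E * (EFin \o v \_ D) x)%E by exact: integrableZl.
have muv : measurable_fun setT (EFin \o (u \_ D \* v \_ D)).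
  by apply/measurable_EFinP; exact: measurable_funM.
have [mMv LMoo] := integrableP _ _ _ LM.
apply/integrableP; split => //.
apply: le_lt_trans LMoo; apply: ae_ge0_le_integral => //.
- exact: measurableT_comp.
- exact: measurableT_comp.
apply: filterS uM => x uM _; rewrite lee_fin !normrM ler_wpM2r//.
by rewrite (ger0_norm M0).
Qed.

Lemma Rintegral_scaleD (a : R) u v : carr (L 1%:E) u -> carr (L 1%:E) v ->
  \int[mu]_(x in D) (a * u x + v x) =
  a * \int[mu]_(x in D) u x + \int[mu]_(x in D) v x.
Proof.
move=> /= /Lfun1_integrable Lu /Lfun1_integrable Lv.
rewrite !(Rintegral_mkcond mu D).
rewrite -RintegralZl// -RintegralD//; last first.
  exact: (integrableZl measurableT a Lu).
apply: eq_Rintegral => x _.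
by rewrite /patch; case: ifP => _ //; rewrite mulr0 addr0.
Qed.

(** An instance of [Rintegral_scaleD] with [u] in both places, since -2u + u = -u. *)
Lemma RintegralN u : carr (L 1%:E) u ->
  \int[mu]_(x in D) (- u x) = - \int[mu]_(x in D) u x.
Proof.
move=> Lu; have := Rintegral_scaleD (-2) Lu Lu; set I := \int[mu]_(x in D) u x.
rewrite (_ : -2 * I + I = - I) => [<-|]; last by ring.
by apply: eq_Rintegral => x _; ring.
Qed.

Lemma Lspace_bounded (M : R) u : measurable D -> (mu D < +oo)%E ->
  measurable_fun D u -> (forall x, D x -> `|u x| <= M) ->
  carr (L 2%:E) u.
Proof.
move=> mD muD /(measurable_restrictT _ mD) mu_ uM.
apply/andP; split; first exact: mem_set.
apply/mem_set; rewrite /finite_norm unlock /Lnorm /= poweR_lty//.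
(* On an empty [D] the bound [M] is unconstrained and may be negative; a point of [D] forces it to
   be non-negative. *)
have [->|/set0P[x0 Dx0]] := eqVneq D set0.
  by rewrite restrict_set0; under eq_integral do rewrite /= normr0 powR0//;
    rewrite integral0.
have M0 : 0 <= M by rewrite (le_trans _ (uM _ Dx0)).
apply: (@le_lt_trans _ _ (\int[mu]_(x in D) (M ^+ 2)%:E)%E); last first.
  by rewrite integral_cst// lte_mul_pinfty ?lee_fin ?sqr_ge0.
rewrite [leRHS]integral_mkcond; apply: ge0_le_integral => //.
- apply/measurable_EFinP.
  apply: (@measurableT_comp _ _ _ _ _ _ (@powR R ^~ 2)) => //.
  exact: measurableT_comp.
- by apply/(measurable_restrictT _ mD); exact: measurable_cst.
- move=> x _; rewrite /patch; case: ifPn => [/set_mem xD|_].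
    by rewrite lee_fin powR_mulrn// ler_pXn2r// ?nnegrE// uM.
  by rewrite lee_fin normr0 powR0.
Qed.

End Lspace_on_theory.

Lemma Lspace_sum (R : realType) disp (T : measurableType disp)
  (mu : {measure set T -> \bar R}) (D : set T) (p : \bar R) (I : Type)
  (s : seq I) (F : I -> T -> R) : (1 <= p)%E ->
  (forall i, carr (Lspace_on mu D p) (F i)) ->
  carr (Lspace_on mu D p) (fun x => \sum_(i <- s) F i x).
Proof.
move=> p1 LF; elim: s => [|i s IH].
  rewrite (_ : (fun _ => _) = 0); first exact: Lspace0.
  by apply/funext => x; rewrite big_nil.
rewrite (_ : (fun _ => _) = 1 *: F i + (fun x => \sum_(j <- s) F j x)).
  exact: (Lspace_scaleD 1 p1 (LF i) IH).
by apply/funext => x; rewrite scale1r big_cons.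
Qed.

(** * Borel sets are Lebesgue measurable *)

Section lebesgue_rV_borel.
Context (R : realType) (d : nat).
Implicit Types (A F : set 'rV[R]_d) (a b x : 'rV[R]_d) (i : 'I_d).

Local Notation leb := (lebesgue_rV R d).
Local Notation lebT := (caratheodory_type (lebesgue_om R d)).

(** Non-emptiness puts [a] below [b] in every coordinate. Without it the product could be negative,
    while the content of the empty set is 0. *)
Lemma box_content_le A a b : A !=set0 -> A `<=` box a b ->
  (box_content A <= (\prod_(i < d) (b ord0 i - a ord0 i))%:E)%E.
Proof.
move=> A0 Aab; rewrite /box_content; case: asboolP => [A_0|_].
  by move: A0; rewrite A_0 => -[].
by apply: ereal_inf_lbound; exists (a, b).
Qed.

(** The hyperplane cuts every box around [A] into two boxes. Their volumes add up to that of the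
    box, as only the [i]-th side is divided: (t - a_i) + (b_i - t) = b_i - a_i. *)
Lemma box_content_split A i t :
  (box_content (A `&` [set x | (x ord0 i <= t)%R]) +
   box_content (A `&` ~` [set x | (x ord0 i <= t)%R]) <= box_content A)%E.
Proof.
set H := [set x | _].
have [->|/set0P A0] := eqVneq A set0.
  by rewrite !set0I box_content0 adde0.
rewrite {3}/box_content; case: asboolP => [A_0|_].
  by move: A0; rewrite A_0 => -[].
apply: le_ereal_inf_tmp => _ [[a b] /= Aab <-].
(* When one half is empty, [t] may lie outside the [i]-th side of the box; the other half is then
   bounded by the whole box. *)
have [E|/set0P [x [Ax Hx]]] := eqVneq (A `&` H) set0.
  rewrite E box_content0 add0e.
  have AE : A `&` ~` H = A.
    apply/seteqP; split => [x []//|x Ax]; split => // Hx.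
    by have : (A `&` H) x by []; rewrite E.
  by rewrite AE; exact: box_content_le.
have [E|/set0P [y [Ay Hy]]] := eqVneq (A `&` ~` H) set0.
  rewrite E box_content0 adde0; apply: box_content_le; first by exists x.
  by move=> z [/Aab].
(* [b'] is the upper corner of the lower box and [a'] the lower corner of the upper box. *)
pose b' := \row_j (if j == i then t else b ord0 j).
pose a' := \row_j (if j == i then t else a ord0 j).
apply: (@le_trans _ _ ((\prod_(i < d) (b' ord0 i - a ord0 i))%:E +
                       (\prod_(i < d) (b ord0 i - a' ord0 i))%:E)%E).
  apply: leeD; apply: box_content_le.
  - by exists x.
  - move=> z [/Aab zab Hz] j; have /andP[az zb] := zab j.
    by rewrite !mxE az /=; case: eqP => // ->.
  - by exists y.
  - move=> z [/Aab zab Hz] j; have /andP[az zb] := zab j.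
    rewrite !mxE zb andbT; case: eqP => // ->.
    by move/negP: Hz; rewrite -ltNge => /ltW.
rewrite -EFinD lee_fin (bigD1 i)//= [X in _ + X](bigD1 i)//= [leRHS](bigD1 i)//=.
rewrite !mxE eqxx.
rewrite (eq_bigr (fun j => b ord0 j - a ord0 j)); last first.
  by move=> j /negbTE ji; rewrite !mxE ji.
rewrite [X in _ + _ * X](eq_bigr (fun j => b ord0 j - a ord0 j)); last first.
  by move=> j /negbTE ji; rewrite !mxE ji.
by rewrite -mulrDl addrC addrA subrK.
Qed.

(** Splitting each member of a cover of [A] along the half-space gives covers of the two halves, so
    [box_content_split] passes from the content to the outer measure and yields the Caratheodory
    criterion. *)
Lemma measurable_halfspace i t :
  measurable ([set x | x ord0 i <= t] : set lebT).
Proof.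
pose H := [set x : 'rV[R]_d | x ord0 i <= t].
apply: (@le_caratheodory_measurable _ _ _ H) => A.
apply: le_ereal_inf_tmp => _ [F AF <-].
have F0 G : (0 <= box_content (G : set 'rV[R]_d))%E := box_content_ge0 G.
apply: (@le_trans _ _ (\sum_(k <oo) box_content (F k `&` H) +
                       \sum_(k <oo) box_content (F k `&` ~` H))%E).
  apply: leeD; apply: ereal_inf_lbound.
  - by exists (fun k => F k `&` H) => //= x [/AF [k _ Fk] Hx]; exists k.
  - by exists (fun k => F k `&` ~` H) => //= x [/AF [k _ Fk] Hx]; exists k.
rewrite -nneseriesD//; apply: lee_nneseries => [k _ _|k _].
  by rewrite adde_ge0.
exact: box_content_split.
Qed.

Lemma measurable_coord i : measurable_fun [set: lebT] (fun x : lebT => (x : 'rV[R]_d) ord0 i).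
Proof.
apply: (measurability _ (RGenOInfty.measurableE R)) => //.
move=> _ [_ [t ->] <-]; rewrite setTI.
rewrite (_ : _ @^-1` _ = ~` [set x : 'rV[R]_d | x ord0 i <= t]).
  by apply: measurableC; exact: measurable_halfspace.
apply/seteqP; split => x /=; rewrite in_itv /= andbT.
  by rewrite ltNge => /negP.
by move/negP; rewrite -ltNge.
Qed.

Lemma measurable_mx_ball (x : 'rV[R]_d) e : measurable (ball x e : set lebT).
Proof.
have [e0|e0] := ltP 0 e; last first.
  rewrite (_ : ball x e = set0)//; apply/seteqP; split => // y -[+ _].
  by rewrite ltNge e0.
(* The balls are those of the sup norm, hence finite intersections of coordinate slabs. *)
rewrite (_ : ball x e = \bigcap_(i in [set: 'I_d])
    ((fun y : lebT => (y : 'rV[R]_d) ord0 i) @^-1` ball (x ord0 i) e)).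
  apply: fin_bigcap_measurable => // i _.
  rewrite -[X in measurable X]setTI; apply: measurable_coord => //.
  exact: measurable_ball.
apply/seteqP; split => y /=; first by move=> [_ H] i _; exact: H.
by move=> H; split => // i j; rewrite !ord1; exact: H.
Qed.

(** An open set is the countable union of the balls inside it that have a rational centre and a
    radius 1/(n+1). *)
Lemma measurable_open (U : set 'rV[R]_d) : open U -> measurable (U : set lebT).
Proof.
move=> oU.
pose B (cn : 'rV[rat]_d * nat) : set 'rV[R]_d :=
  ball (map_mx ratr cn.1 : 'rV[R]_d) (cn.2.+1%:R^-1 : R).
rewrite (_ : U = \bigcup_k (if unpickle k is Some cn then
    (if `[< B cn `<=` U >] then B cn else set0) else set0)).
  apply: bigcupT_measurable => k; case: (unpickle k) => // cn.
  by case: ifP => // _; exact: measurable_mx_ball.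
apply/seteqP; split => [x Ux|x [k _]]; last first.
  by case: (unpickle k) => // cn; case: asboolP => // + ?; apply.
have /nbhs_ballP[e /= e0 xeU] : nbhs x U by exact: open_nbhs_nbhs.
(* With a radius below [e / 2], any such ball containing [x] lies in the ball of radius [e] around
   [x]. *)
have [n ne] : exists n, n.+1%:R^-1 < e / 2 :> R.
  have e2 : 0 < e / 2 by rewrite divr_gt0.
  by have [n _ /(_ n (leqnn n))] := near_infty_natSinv_lt (PosNum e2); exists n.
have n0 : 0 < n.+1%:R^-1 :> R by rewrite invr_gt0.
have [r rE] : exists r : R, r = n.+1%:R^-1 by eexists.
rewrite -rE in ne n0.
have /choice[c xc] : forall i, exists q : rat, `|ratr q - x ord0 i| < r.
  move=> i.
  have [q] : exists q, ratr q \in `](x ord0 i - r), (x ord0 i + r)[.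
    by apply: rat_in_itvoo; lra.
  rewrite in_itv /= => /andP[q1 q2]; exists q.
  by rewrite ltr_norml; apply/andP; split; lra.
pose cn := (\row_i c i, n) : 'rV[rat]_d * nat.
exists (pickle cn) => //; rewrite pickleK.
have Bx : B cn x.
  by split => [|i j]; rewrite /= -rE // !ord1 !mxE /ball /= xc.
case: asboolP => // -[] y [_ cy]; apply: xeU; split => // i j.
rewrite !ord1 /ball /=.
have := cy ord0 j; rewrite /B /= -rE !mxE /ball /= => cyj.
have := xc j; rewrite distrC => xcj.
by apply: (le_lt_trans (ler_distD (ratr (c j)) _ _)); lra.
Qed.

Lemma measurable_continuous (f : 'rV[R]_d -> R) : continuous f ->
  measurable_fun [set: lebT] (f : lebT -> R).
Proof.
move=> /continuousP cf; apply: (measurability _ (RGenOpens.measurableE R)) => //.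
move=> _ [_ [a [b ->] <-]]; rewrite setTI.
apply: measurable_open; apply: cf; exact: interval_open.
Qed.

Lemma lebesgue_bounded_lty A : bounded_set A -> (leb A < +oo)%E.
Proof.
move=> [M [_ /(_ (M + 1))]]; rewrite ltrDl ltr01 => /(_ isT) AM.
have [->|/set0P A0] := eqVneq A set0; first by rewrite measure0 ltry.
pose m := M + 1.
have Abox : A `<=` box (\row_i (- m)) (\row_i m).
  move=> x /AM xm i; rewrite !mxE -ler_norml.
  apply: le_trans xm; rewrite [leRHS]/Num.norm /= mx_normrE.
  by apply/bigmax_geP; right => /=; exists (ord0, i).
(* [A] covers itself, and its content is at most the volume of a cube. *)
pose F (k : nat) : set 'rV[R]_d := if k == 0%N then A else set0.
apply: (@le_lt_trans _ _ (\sum_(k <oo) box_content (F k))%E).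
  by apply: ereal_inf_lbound; exists F => // x Ax; exists 0%N.
rewrite (@nneseries_split _ _ 0 1)//; last by move=> k _; exact: box_content_ge0.
rewrite big_nat1 eseries0 ?adde0; last first.
  by case=> // k _ _; rewrite box_content0.
exact: (le_lt_trans (box_content_le A0 Abox) (ltry _)).
Qed.

Lemma continuous_bounded_on (A : set 'rV[R]_d) (f : 'rV[R]_d -> R) :
  bounded_set A -> continuous f -> exists M : R, forall x, A x -> `|f x| <= M.
Proof.
move=> [m [_ /(_ (m + 1))]]; rewrite ltrDl ltr01 => /(_ isT) Am cf.
(* [A] need not be closed, so compactness is taken from a closed ball around it, on which [f] is
   still continuous. *)
pose K := [set x : 'rV[R]_d | `|x| <= m + 1].
have bK : bounded_set K.
  exists (m + 1); split; first exact: num_real.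
  by move=> y /ltW my x /le_trans; exact.
have cK : closed K.
  rewrite (_ : K = (fun x : 'rV[R]_d => `|x|) @^-1` [set x | x <= m + 1])//.
  apply: closed_comp; last exact: closed_le.
  by move=> x _; exact: norm_continuous.
have fK : compact (f @` K).
  apply: continuous_compact; last exact: bounded_closed_compact.
  exact: continuous_subspaceT.
have [M [_ /(_ (M + 1))]] := compact_bounded fK.
rewrite ltrDl ltr01 => /(_ isT) fM; exists (M + 1) => x /Am Kx.
by apply: fM; exists x.
Qed.

(** Puts test functions and their derivatives in L^2, which makes the products in [weak_partial]
    integrable. *)
Lemma continuous_Lp_Om (Om : set 'rV[R]_d) (f : 'rV[R]_d -> R) :
  open Om -> bounded_set Om -> continuous f -> carr (Lp_Om Om 2%:E) f.
Proof.
move=> oOm bOm cf; have mOm := measurable_open oOm.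
have [M fM] := continuous_bounded_on bOm cf.
apply: (Lspace_bounded mOm (lebesgue_bounded_lty bOm) _ fM).
by apply/measurable_funTS/measurable_continuous.
Qed.

End lebesgue_rV_borel.

(** * Sobolev functions and traces *)

Lemma sum_sqr_le (R : realType) (I : Type) (s : seq I) (x : I -> R) :
  (forall i, 0 <= x i) -> \sum_(i <- s) x i ^+ 2 <= (\sum_(i <- s) x i) ^+ 2.
Proof.
move=> x0; elim: s => [|i s IH]; first by rewrite !big_nil expr0n.
rewrite !big_cons sqrrD; have : 0 <= \sum_(j <- s) x j by exact: sumr_ge0.
have := x0 i => {}x0 s0; apply: (le_trans (lerD (lexx _) IH)).
by rewrite -addrA lerD2l lerDr mulrn_wge0// mulr_ge0.
Qed.

(** [C] makes room for the factor in [H1_nrm_scaleD]. *)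
Lemma cvg0_squeeze_lincomb (R : realType) (C b : R) (r p q : R^nat) :
  (forall n, 0 <= r n <= C * (b * p n + q n)) ->
  p n @[n --> \oo] --> 0 -> q n @[n --> \oo] --> 0 -> r n @[n --> \oo] --> 0.
Proof.
move=> rpq p0 q0.
apply: (@squeeze_cvgr _ _ _ _ (cst 0) (fun n => C * (b * p n + q n))).
- by near=> n; exact: rpq.
- exact: cvg_cst.
- have -> : 0 = C * (b * 0 + 0) by rewrite mulr0 addr0 mulr0.
  exact: (cvgM (cvg_cst C) (cvgD (cvgM (cvg_cst b) p0) q0)).
Unshelve. all: by end_near. Qed.

Section sobolev_theory.
Context (R : realType) (d : nat) (Om : set 'rV[R]_d).
Hypotheses (oOm : open Om) (bOm : bounded_set Om).
Implicit Types (i : 'I_d) (f g : 'rV[R]_d -> R) (u v : sobfun R d).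

Local Notation H1 := (sobolev Om 2).
Local Notation leb := (lebesgue_rV R d).

Lemma partial_scaleD i (a : R) f g :
  (forall x, derivable f x (delta_mx ord0 i)) ->
  (forall x, derivable g x (delta_mx ord0 i)) ->
  partial i (a *: f + g) = a *: partial i f + partial i g.
Proof.
move=> df dg; apply/funext => x; rewrite /partial.
rewrite deriveD//; last exact: derivableZ.
by rewrite deriveZ.
Qed.

Lemma foldr_partial_scaleD (a : R) f g (s : seq 'I_d) : smooth f -> smooth g ->
  foldr (@partial R d) (a *: f + g) s =
  a *: foldr (@partial R d) f s + foldr (@partial R d) g s.
Proof.
move=> sf sg; elim: s => //= i s ->.
by rewrite partial_scaleD// => x; [have [_] := sf s|have [_] := sg s].
Qed.

Lemma smooth_scaleD (a : R) f g : smooth f -> smooth g -> smooth (a *: f + g).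
Proof.
move=> sf sg s; rewrite foldr_partial_scaleD//.
have [cf df] := sf s; have [cg dg] := sg s; split.
  by move=> x; exact: (cvgD (cvgZ (cvg_cst a) (cf x)) (cg x)).
by move=> i x; apply: derivableD => //; exact: derivableZ.
Qed.

Lemma smooth_partial_scaleD i (a : R) f g : smooth f -> smooth g ->
  partial i (a *: f + g) = a *: partial i f + partial i g.
Proof. by move=> sf sg; exact: (foldr_partial_scaleD a [:: i] sf sg). Qed.

Lemma weak_partial_scaleD i (a : R) (u u' g g' : 'rV[R]_d -> R) :
  carr (Lp_Om Om 2%:E) u -> carr (Lp_Om Om 2%:E) u' ->
  carr (Lp_Om Om 2%:E) g -> carr (Lp_Om Om 2%:E) g' ->
  weak_partial Om i u g -> weak_partial Om i u' g' ->
  weak_partial Om i (a *: u + u') (a *: g + g').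
Proof.
move=> Lu Lu' Lg Lg' wu wu' phi tphi.
have [sphi _] := tphi.
have Lphi : carr (Lp_Om Om 2%:E) phi.
  by apply: continuous_Lp_Om => //; have [] := sphi [::].
have Ldphi : carr (Lp_Om Om 2%:E) (partial i phi).
  by apply: continuous_Lp_Om => //; have [] := sphi [:: i].
transitivity (\int[leb]_(x in Om)
    (a * (u x * partial i phi x) + u' x * partial i phi x)).
  by apply: eq_Rintegral => x _; rewrite !fctE mulrDl mulrA.
rewrite (Rintegral_scaleD a (Lspace2_mul Lu Ldphi) (Lspace2_mul Lu' Ldphi)).
transitivity (- \int[leb]_(x in Om) (a * (g x * phi x) + g' x * phi x)); last first.
  by congr (- _); apply: eq_Rintegral => x _; rewrite !fctE mulrDl mulrA.
rewrite (Rintegral_scaleD a (Lspace2_mul Lg Lphi) (Lspace2_mul Lg' Lphi)).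
by rewrite (wu _ tphi) (wu' _ tphi) mulrN opprD.
Qed.

Let p1 : (1 <= 2%:E :> \bar R)%E. Proof. by rewrite lee_fin ler1n. Qed.

Lemma sobfun_scaleD1 (a : R) u v : (a *: u + v).1 = a *: u.1 + v.1.
Proof. by []. Qed.

Lemma sobfun_scaleD2 (a : R) u v i : (a *: u + v).2 i = a *: u.2 i + v.2 i.
Proof.
exact: (etrans (congr1 (@^~ i) (pair_scaleD2 a u v)) (fct_scaleD a u.2 v.2 i)).
Qed.

Lemma H1_scaleD (a : R) u v : carr H1 u -> carr H1 v -> carr H1 (a *: u + v).
Proof.
move=> [Lu Wu] [Lv Wv]; split.
  by rewrite sobfun_scaleD1; exact: Lspace_scaleD.
move=> i; have [Lui wu] := Wu i; have [Lvi wv] := Wv i.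
rewrite sobfun_scaleD1 sobfun_scaleD2; split; first exact: Lspace_scaleD.
exact: weak_partial_scaleD.
Qed.

Lemma H1_nrm_ge0 u : 0 <= nrm H1 u.
Proof. exact: powR_ge0. Qed.

Lemma H1_nrmE u : nrm H1 u = Num.sqrt (nrm (Lp_Om Om 2%:E) u.1 ^+ 2 +
  \sum_(i < d) nrm (Lp_Om Om 2%:E) (u.2 i) ^+ 2).
Proof.
rewrite [LHS]/nrm/= powR_mulrn ?Lspace_nrm_ge0//.
under eq_bigr do rewrite powR_mulrn ?Lspace_nrm_ge0//.
by rewrite powR12_sqrt// addr_ge0 ?sqr_ge0// sumr_ge0// => i _; rewrite sqr_ge0.
Qed.

(** A triangle inequality up to a constant is enough to carry convergence to 0 through linear
    combinations. The Euclidean norm of the [d.+1] component seminorms is at most their sum, and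
    each of them is at most [B]. *)
Lemma H1_nrm_scaleD (a : R) u v : carr H1 u -> carr H1 v ->
  nrm H1 (a *: u + v) <= d.+1%:R * (`|a| * nrm H1 u + nrm H1 v).
Proof.
move=> [Lu Wu] [Lv Wv]; set B := `|a| * _ + _.
(* Index 0 stands for the function itself and the others for the components of its gradient. *)
pose n (w : sobfun R d) (k : 'I_d.+1) : R :=
  nrm (Lp_Om Om 2%:E) (if unlift ord0 k is Some i then w.2 i else w.1).
have n0 (w : sobfun R d) k : 0 <= n w k by exact: Lspace_nrm_ge0.
have nE (w : sobfun R d) : nrm H1 w = Num.sqrt (\sum_k n w k ^+ 2).
  rewrite H1_nrmE big_ord_recl /n unlift_none.
  by under [X in _ = _ (_ + X)]eq_bigr do rewrite liftK.
have n_le (w : sobfun R d) k : n w k <= nrm H1 w.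
  rewrite nE -[leLHS]ger0_norm// -sqrtr_sqr ler_wsqrtr// (bigD1 k)//= lerDl.
  by apply: sumr_ge0 => j _; exact: sqr_ge0.
have nB k : n (a *: u + v) k <= B.
  apply: (@le_trans _ _ (`|a| * n u k + n v k)).
    rewrite /n; case: (unlift ord0 k) => [i|]; last first.
      by rewrite sobfun_scaleD1; exact: Lspace_nrm_scaleD.
    rewrite sobfun_scaleD2; have [Lui _] := Wu i; have [Lvi _] := Wv i.
    exact: Lspace_nrm_scaleD.
  by rewrite lerD// ler_wpM2l.
rewrite nE; apply: (@le_trans _ _ (\sum_k n (a *: u + v) k)).
  rewrite -[leRHS]ger0_norm ?sumr_ge0// -sqrtr_sqr ler_wsqrtr//.
  exact: sum_sqr_le.
apply: (le_trans (ler_sum _ (fun k _ => nB k))).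
by rewrite sumr_const card_ord mulr_natl.
Qed.

Definition with_grad f : sobfun R d := (f, fun i => partial i f).

Lemma with_grad_scaleD (a : R) f g : smooth f -> smooth g ->
  with_grad (a *: f + g) = a *: with_grad f + with_grad g.
Proof.
move=> sf sg; apply: (@eq_trans _ _ (a *: f + g, a *: (with_grad f).2 + (with_grad g).2)).
  congr pair; apply/funext => i; rewrite smooth_partial_scaleD//.
by [].
Qed.

(** The same linear combination of the two smooth approximating sequences approximates both the
    function and its trace. *)
Lemma trace_of_scaleD (a : R) u v f g : trace_of Om u f -> trace_of Om v g ->
  trace_of Om (a *: u + v) (a *: f + g).
Proof.
move=> [Hu Lf [phi [Hphi phiu phif]]] [Hv Lg [psi [Hpsi psiv psig]]].
split; [exact: H1_scaleD|exact: Lspace_scaleD|].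
exists (fun n => a *: phi n + psi n).
pose P n := with_grad (phi n); pose Q n := with_grad (psi n).
have PQ n : with_grad (a *: phi n + psi n) = a *: P n + Q n.
  by have [sphi _ _] := Hphi n; have [spsi _ _] := Hpsi n; exact: with_grad_scaleD.
have HP n : carr H1 (P n) by have [_ + _] := Hphi n.
have HQ n : carr H1 (Q n) by have [_ + _] := Hpsi n.
have HN w z : carr H1 w -> carr H1 z -> carr H1 (w - z).
  by move=> Hw Hz; rewrite -scaleN1r addrC; exact: H1_scaleD.
split.
- move=> n; have [sphi Pphi Bphi] := Hphi n; have [spsi Ppsi Bpsi] := Hpsi n.
  split; first exact: smooth_scaleD.
    rewrite -[X in carr _ X]/(with_grad (a *: phi n + psi n)) PQ.
    exact: (H1_scaleD a (HP n) (HQ n)).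
  exact: (Lspace_scaleD a p1 Bphi Bpsi).
- apply: (cvg0_squeeze_lincomb (C := d.+1%:R) (b := `|a|) _ phiu psiv) => n.
  rewrite H1_nrm_ge0 andTb.
  rewrite -[X in nrm _ (X - _)]/(with_grad (a *: phi n + psi n)) PQ.
  have -> : a *: P n + Q n - (a *: u + v) = a *: (P n - u) + (Q n - v).
    by rewrite scalerBr opprD addrACA.
  exact: (H1_nrm_scaleD a (HN _ _ (HP n) Hu) (HN _ _ (HQ n) Hv)).
- apply: (cvg0_squeeze_lincomb (C := 1) (b := `|a|) _ phif psig) => n.
  rewrite Lspace_nrm_ge0 andTb mul1r.
  have -> : a *: phi n + psi n - (a *: f + g) = a *: (phi n - f) + (psi n - g).
    by rewrite scalerBr opprD addrACA.
  have [_ _ Bphi] := Hphi n; have [_ _ Bpsi] := Hpsi n.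
  have LN w z : carr (Lp_bdry Om 2%:E) w -> carr (Lp_bdry Om 2%:E) z ->
      carr (Lp_bdry Om 2%:E) (w - z).
    by move=> Lw Lz; rewrite -scaleN1r addrC; exact: (Lspace_scaleD (-1) p1 Lz Lw).
  exact: (Lspace_nrm_scaleD a p1 (LN _ _ Bphi Lf) (LN _ _ Bpsi Lg)).
Qed.

End sobolev_theory.

(** * Linearity of the operators *)

Section elliptic_theory.
Context (R : realType) (d : nat) (Om : set 'rV[R]_d).
Hypotheses (oOm : open Om) (bOm : bounded_set Om).
Variables (aij : 'I_d -> 'I_d -> 'rV[R]_d -> R) (c r : 'rV[R]_d -> R).
Hypothesis Laij : forall i j, carr (Lp_Om Om +oo) (aij i j).
Hypothesis Lc : carr (Lp_Om Om +oo) c.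
Hypothesis Lr : carr (Lp_bdry Om +oo) r.
Variable q' : R.
Implicit Types (p y u v : sobfun R d) (gp gy gu gv f g : 'rV[R]_d -> R).

Local Notation H1 := (sobolev Om 2).
Local Notation W := (sobolev Om q').
Local Notation leb := (lebesgue_rV R d).

Let p1 : (1 <= 1%:E :> \bar R)%E. Proof. by []. Qed.

Definition aform_density y p (x : 'rV[R]_d) : R :=
  \sum_(i < d) \sum_(j < d) aij i j x * y.2 i x * p.2 j x + c x * y.1 x * p.1 x.

(** Every term is a bounded coefficient times a product of two L^2 functions. *)
Lemma aform_density_L1 y p : carr H1 y -> carr H1 p ->
  carr (Lp_Om Om 1%:E) (aform_density y p).
Proof.
move=> [Ly Dy] [Lp Dp].
rewrite (_ : aform_density y p =
  1 *: (fun x => \sum_(i < d) \sum_(j < d) aij i j x * (y.2 i x * p.2 j x)) +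
  (fun x => c x * (y.1 x * p.1 x))).
  apply: (Lspace_scaleD 1 p1); last exact: (Lspacey_mul1 Lc (Lspace2_mul Ly Lp)).
  apply: (Lspace_sum _ p1) => i; apply: (Lspace_sum _ p1) => j.
  have [Lyi _] := Dy i; have [Lpj _] := Dp j.
  exact: (Lspacey_mul1 (Laij i j) (Lspace2_mul Lyi Lpj)).
apply/funext => x; rewrite scale1r /aform_density fctE mulrA; congr (_ + _).
by apply: eq_bigr => i _; apply: eq_bigr => j _; rewrite mulrA.
Qed.

Lemma bdry_density_L1 gy gp : carr (Lp_bdry Om 2%:E) gy ->
  carr (Lp_bdry Om 2%:E) gp ->
  carr (Lp_bdry Om 1%:E) (fun x => r x * gy x * gp x).
Proof.
move=> Ly Lp; rewrite (_ : (fun _ => _) = fun x => r x * (gy x * gp x)).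
  exact: (Lspacey_mul1 Lr (Lspace2_mul Ly Lp)).
by apply/funext => x; rewrite mulrA.
Qed.

Lemma aform_scaleD (a : R) y gy u gu v gv :
  trace_of Om y gy -> trace_of Om u gu -> trace_of Om v gv ->
  aform Om aij c r y gy (a *: u + v) (a *: gu + gv) =
  a * aform Om aij c r y gy u gu + aform Om aij c r y gy v gv.
Proof.
move=> [Hy Lgy _] [Hu Lgu _] [Hv Lgv _]; rewrite /aform.
rewrite mulrDr addrACA -Rintegral_scaleD; try exact: aform_density_L1.
rewrite -Rintegral_scaleD; try exact: bdry_density_L1.
congr (_ + _); apply: eq_Rintegral => x _; last first.
  by rewrite fct_scaleD /GRing.scale /=; ring.
rewrite [a * _]mulrDr [RHS]addrACA; congr (_ + _); last first.
  by rewrite sobfun_scaleD1 fct_scaleD /GRing.scale /=; ring.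
rewrite mulr_sumr -big_split; apply: eq_bigr => i _.
rewrite [X in _ = X + _]mulr_sumr -big_split; apply: eq_bigr => j _.
by rewrite sobfun_scaleD2 fct_scaleD /GRing.scale /=; ring.
Qed.

(** [dom_A] bounds the form from above only; testing with [- y] makes the bound two-sided. *)
Lemma aformN y gy p gp : trace_of Om y gy -> trace_of Om p gp ->
  aform Om aij c r (- y) (- gy) p gp = - aform Om aij c r y gy p gp.
Proof.
move=> [Hy Lgy _] [Hp Lgp _]; rewrite /aform opprD.
rewrite -RintegralN; last exact: aform_density_L1.
rewrite -RintegralN; last exact: bdry_density_L1.
congr (_ + _); apply: eq_Rintegral => x _; last first.
  by rewrite fct_oppr; ring.
rewrite opprD; congr (_ + _); last first.
  by rewrite (_ : (- y).1 = - y.1)// fct_oppr; ring.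
rewrite -sumrN; apply: eq_bigr => i _; rewrite -sumrN; apply: eq_bigr => j _.
have -> : (- y).2 i = - y.2 i.
  exact: (etrans (congr1 (@^~ i) (pair_oppr2 y)) (fct_oppr y.2 i)).
by rewrite fct_oppr; ring.
Qed.

Lemma sobolev_nrmN y : nrm W (- y) = nrm W y.
Proof.
rewrite /nrm/=; congr ((_ `^ _ + _) `^ _).
  by rewrite -[RHS]Lspace_nrmN.
apply: eq_bigr => i _; congr (_ `^ _); rewrite fct_oppr.
by rewrite -[RHS]Lspace_nrmN.
Qed.

Lemma trace_ofN y gy : trace_of Om y gy -> trace_of Om (- y) (- gy).
Proof.
move=> ty; have := trace_of_scaleD oOm bOm (-2) ty ty.
have N (V : lmodType R) (w : V) : -2 *: w + w = - w.
  by rewrite -[X in _ + X]scale1r -scalerDl -scaleN1r; congr (_ *: _); ring.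
by rewrite !N.
Qed.

Lemma dom_A_scaleD (a : R) u v : dom_A Om aij c r q' u -> dom_A Om aij c r q' v ->
  dom_A Om aij c r q' (a *: u + v).
Proof.
move=> [Hu [gu [tu [cu uC]]]] [Hv [gv [tv [cv vC]]]].
split; first exact: (H1_scaleD oOm bOm a Hu Hv).
exists (a *: gu + gv); split; first exact: (trace_of_scaleD oOm bOm a tu tv).
exists (`|a| * cu + cv) => y gy Hy ty.
rewrite aform_scaleD// mulrDl -mulrA lerD ?vC//.
have le1 := uC _ _ Hy ty.
(* The sign of [a] is unknown, so the absolute value of the form at [u] has to be bounded. *)
have tNy := trace_ofN ty; have [HNy _ _] := tNy.
have := uC _ _ HNy tNy; rewrite aformN// sobolev_nrmN => le2.
apply: (le_trans (ler_norm _)); rewrite normrM ler_wpM2l// ler_norml le1 andbT.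
by rewrite lerNl.
Qed.

Lemma A_graph_scaleD (a : R) (phi psi : 'rV[R]_d -> R) (f g : sobfun R d -> R) :
  A_graph Om aij c r q' (phi, f) -> A_graph Om aij c r q' (psi, g) ->
  A_graph Om aij c r q' (a *: phi + psi, a *: f + g).
Proof.
move=> [u [gu [Du [cphi phiu] df tu fu]]] [v [gv [Dv [cpsi psiv] dg tv gv_]]].
exists (a *: u + v), (a *: gu + gv); split.
- exact: dom_A_scaleD.
- split; first exact: cont_space_scaleD.
  apply: (@filterS2 _ (almost_everywhere leb) (ae_filter_ringOfSetsType leb)
    _ _ _ _ phiu psiv) => x /= phiux psivx Ox.
  by rewrite fct_scaleD phiux// psivx.
- exact: dual_scaleD.
- exact: (trace_of_scaleD oOm bOm a tu tv).
- move=> y gy Hy ty; rewrite aform_scaleD//.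
  by rewrite -(fu _ _ Hy ty) -(gv_ _ _ Hy ty) [LHS]/= fct_scaleD.
Qed.

Variables (omc omo : set 'rV[R]_d) (muo : {measure set (borel_rV R d) -> \bar R}).
Variable E : set (sobfun R d * ('rV[R]_d -> R)).
Hypothesis lE : linear_operator W (L2_obs omo muo) E.

Let p2 : (1 <= 2%:E :> \bar R)%E. Proof. by rewrite lee_fin ler1n. Qed.

Lemma E_adj_scaleD (a : R) (h k : 'rV[R]_d -> R) (f g : sobfun R d -> R) :
  E_adj Om q' omo muo E (h, f) -> E_adj Om q' omo muo E (k, g) ->
  E_adj Om q' omo muo E (a *: h + k, a *: f + g).
Proof.
move=> [Lh df hf] [Lk dg kg]; split.
- exact: (Lspace_scaleD a p2 Lh Lk).
- exact: dual_scaleD.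
(* The range of [E] lies in L^2, so the products of [z] with [h] and [k] are integrable and the
   pairing is additive. *)
- move=> u z Euz; have [sE _ _ _] := lE; have [_ Lz] := sE _ Euz.
  rewrite [LHS]/= fct_scaleD.
  have /= -> := hf _ _ Euz; have /= -> := kg _ _ Euz.
  rewrite -[LHS](Rintegral_scaleD a (Lspace2_mul Lz Lh) (Lspace2_mul Lz Lk)).
  by apply: eq_Rintegral => x _; rewrite /= fct_scaleD /GRing.scale /=; ring.
Qed.

Lemma S_graph_scaleD (a : R) (h k w z : 'rV[R]_d -> R) :
  S_graph Om aij c r q' omc omo muo E (h, w) ->
  S_graph Om aij c r q' omc omo muo E (k, z) ->
  S_graph Om aij c r q' omc omo muo E (a *: h + k, a *: w + z).
Proof.
move=> [phi [[f [Ehf Af]] [cphi cw wphi]]] [psi [[g [Ekg Ag]] [cpsi cz zpsi]]].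
exists (a *: phi + psi); split.
  exists (a *: f + g); split; first exact: E_adj_scaleD.
  exact: A_graph_scaleD.
split => /=; [exact: cont_space_scaleD|exact: cont_space_scaleD|].
move=> x Kx; rewrite !fct_scaleD.
by have /= -> := wphi x Kx; have /= -> := zpsi x Kx.
Qed.

End elliptic_theory.

(** * Convex duality *)

Section hahn_banach.
Context (R : realType) (V : lmodType R) (S : set V) (p : V -> R).
Hypothesis S0 : S 0.
Hypothesis S_scaleD : forall (a : R) u v, S u -> S v -> S (a *: u + v).
Hypothesis p_convex : forall (s t : R) u v, 0 < s -> 0 < t -> s + t = 1 ->
  S u -> S v -> p (s *: u + t *: v) <= s * p u + t * p v.
Hypothesis p0_ge0 : 0 <= p 0.

(** Being single-valued is automatic: if [(0, r)] is in [G] then so is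
    [(0, t * r)], hence [t * r <= p 0] for all [t]. *)
Definition dominated_linear_graph (G : set (V * R)) : Prop :=
  (forall v r, G (v, r) -> S v /\ r <= p v) /\
  (forall (a : R) u r v s, G (u, r) -> G (v, s) -> G (a *: u + v, a * r + s)).

(** The chain condition for Zorn: of two graphs in a chain, the larger contains the points of
    both. *)
Lemma dominated_linear_graph_bigcup (F : set (set (V * R))) :
  F `<=` dominated_linear_graph -> total_on F subset ->
  dominated_linear_graph (\bigcup_(G in F) G).
Proof.
move=> FP totF; split=> [v r [G FG Gvr]|a u r v s [G FG Gur] [H FH Hvs]].
  exact: (FP _ FG).1.
have [GH|HG] := totF _ _ FG FH.
  by exists H => //; apply: (FP _ FH).2 => //; exact: GH.
by exists G => //; apply: (FP _ FG).2 => //; exact: HG.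
Qed.

(** Each lower bound for a value at [v0] is below each upper bound. In the convex combination of
    [v1 - s *: v0] and [v2 + t *: v0] with weights t/(s+t) and s/(s+t) the vector [v0] cancels;
    domination of [G] at this point and convexity of [p] give the inequality. *)
Lemma dominated_linear_graph_gap (G : set (V * R)) (v0 v1 v2 : V) (r1 r2 s t : R) :
  dominated_linear_graph G -> G (0, 0) -> S v0 -> 0 < s -> 0 < t ->
  G (v1, r1) -> G (v2, r2) ->
  (r1 - p (v1 - s *: v0)) / s <= (p (v2 + t *: v0) - r2) / t.
Proof.
move=> [GS Glin] G0 Sv0 s0 t0 G1 G2.
have st0 : 0 < s + t by rewrite addr_gt0.
pose k := (s + t)^-1; have k0 : 0 < k by rewrite invr_gt0.
have S1 : S (v1 - s *: v0).
  by rewrite addrC -scaleNr; apply: S_scaleD => //; have [] := GS _ _ G1.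
have S2 : S (v2 + t *: v0).
  by rewrite addrC; apply: S_scaleD => //; have [] := GS _ _ G2.
have kst : k * t + k * s = 1 by rewrite -mulrDr addrC mulVf// gt_eqF.
have [_] := GS _ _ (Glin (k * t) _ _ _ _ G1 (Glin (k * s) _ _ _ _ G2 G0)).
have -> : (k * t) *: v1 + ((k * s) *: v2 + 0) =
    (k * t) *: (v1 - s *: v0) + (k * s) *: (v2 + t *: v0).
  rewrite addr0 scalerBr scalerDr !scalerA addrACA.
  by rewrite (_ : k * t * s = k * s * t) ?addNr ?addr0//; ring.
move=> /le_trans/(_ (p_convex (mulr_gt0 k0 t0) (mulr_gt0 k0 s0) kst S1 S2)).
set q1 := p _; set q2 := p _ => h.
rewrite ler_pdivrMr// mulrAC ler_pdivlMr// -(ler_pM2l k0).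
by move: h; rewrite addr0; clearbody q1 q2; clear; lra.
Qed.

(** The value at [v0] is the supremum of the lower bounds [L]. Negative multiples of [v0] use that
    it is an upper bound of [L], positive ones that it is the least, by the gap lemma. *)
Lemma dominated_linear_graph_extend (G : set (V * R)) (v0 : V) :
  dominated_linear_graph G -> G (0, 0) -> S v0 -> exists s,
  dominated_linear_graph
    [set x | exists v r t, G (v, r) /\ x = (v + t *: v0, r + t * s)].
Proof.
move=> PG G0 Sv0; have [GS Glin] := PG.
pose L := [set l : R | exists v r s, [/\ G (v, r), 0 < s &
  l = (r - p (v - s *: v0)) / s]].
have L_le (v : V) (r t : R) : G (v, r) -> 0 < t -> ubound L ((p (v + t *: v0) - r) / t).
  move=> Gvr t0 _ [v1 [r1 [s1 [G1 s10 ->]]]].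
  exact: (dominated_linear_graph_gap PG G0 Sv0 s10 t0 G1 Gvr).
have L0 : L !=set0 by exists ((0 - p (0 - 1 *: v0)) / 1), 0, 0, 1.
have supL : has_sup L.
  by split => //; exists ((p (0 + 1 *: v0) - 0) / 1); exact: L_le.
exists (sup L); split; last first.
  move=> a _ _ _ _ [u [r [t [Gu [-> ->]]]]] [v [r' [t' [Gv [-> ->]]]]].
  exists (a *: u + v), (a * r + r'), (a * t + t'); split; first exact: Glin.
  by congr pair; [rewrite scalerDr scalerA scalerDl addrACA|ring].
move=> _ _ [v [r [t [Gvr [-> ->]]]]]; have [Sv rp] := GS _ _ Gvr; split.
  by rewrite addrC; exact: S_scaleD.
have [t0|t0|->] := ltgtP t 0.
- have Nt0 : 0 < - t by rewrite oppr_gt0.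
  have : (r - p (v - (- t) *: v0)) / - t <= sup L.
    by apply: ub_le_sup; [exact: supL.2|exists v, r, (- t)].
  rewrite ler_pdivrMr// scaleNr opprK; lra.
- have := ge_sup L0 (L_le _ _ _ Gvr t0).
  rewrite ler_pdivlMr//; lra.
- by rewrite scale0r mul0r !addr0.
Qed.

Lemma hahn_banach_convex : exists f : V -> R,
  (forall (a : R) u v, S u -> S v -> f (a *: u + v) = a * f u + f v) /\
  (forall u, S u -> f u <= p u).
Proof.
have [G [PG Gmax]] := Zorn_bigcup dominated_linear_graph_bigcup.
have [GS Glin] := PG.
(* The empty graph is dominated and linear too, so this rests on maximality. A graph with any point
   contains [(0, 0)]; one without it is empty and can be enlarged by [(0, 0)], because [p 0] is
   non-negative. *)
have G0 : G (0, 0).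
  apply: contrapT => nG0; apply: (Gmax (G `|` [set (0, 0)])).
    by split => [x|]; [left|move=> /(_ (0, 0)) H; apply: nG0; apply: H; right].
  have GE x : G x -> False.
    case: x => v r Gx; apply: nG0; have := Glin (-1) _ _ _ _ Gx Gx.
    by rewrite scaleN1r addNr mulN1r addNr.
  split=> [v r [/GE//|[-> ->]]//|a u r v s [/GE//|[-> ->]] [/GE//|[-> ->]]].
  by right; rewrite scaler0 mulr0 !addr0.
have Gfun v r r' : G (v, r) -> G (v, r') -> r = r'.
  suff {r r'} H r r' : G (v, r) -> G (v, r') -> r <= r'.
    by move=> Gr Gr'; apply/eqP; rewrite eq_le !H.
  move=> Gr Gr'; rewrite leNgt; apply/negP => rr'.
  have D := Glin (-1) _ _ _ _ Gr' Gr.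
  rewrite scaleN1r addNr in D.
  have d0 : 0 < -1 * r' + r by lra.
  (* This multiple takes the value at 0 to [p 0 + 1], against domination. *)
  pose t := (p 0 + 1) / (-1 * r' + r).
  have [_] := GS _ _ (Glin t _ _ _ _ D G0).
  by rewrite scaler0 !addr0 /t mulfVK ?gt_eqF//; lra.
have Gtot v : S v -> exists r, G (v, r).
  move=> Sv; apply: contrapT => nG.
  have [s PB] := dominated_linear_graph_extend PG G0 Sv.
  apply: (Gmax _ _ PB); split => [[u r] Gur|].
    by exists u, r, 0; split => //; rewrite scale0r mul0r !addr0.
  move=> /(_ (v, s)) H; apply: nG; exists s; apply: H.
  by exists 0, 0, 1; split => //; rewrite scale1r mul1r !add0r.
(* Outside [S] the graph has no value and [f] is 0 by default. *)
pose f v := xget 0 [set r | G (v, r)].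
have fG v : S v -> G (v, f v).
  by move=> /Gtot [r Gvr]; exact: (xgetI (P := [set r | G (v, r)]) 0 Gvr).
exists f; split => [a u v Su Sv|u Su]; last by have [] := GS _ _ (fG _ Su).
apply: (Gfun (a *: u + v)); first by apply: fG; exact: S_scaleD.
by apply: Glin; exact: fG.
Qed.

End hahn_banach.

(** * The sup norm on a compact set *)

Section cont_space_norm.
Context (R : realType) (T : topologicalType) (K : set T).
Hypothesis cK : compact K.

Lemma cont_space_le_nrm (v : T -> R) x : carr (cont_space R K) v -> K x ->
  `|v x| <= nrm (cont_space R K) v.
Proof.
move=> cv Kx; have vK : compact (v @` K) by exact: continuous_compact.
have [M [_ /(_ (M + 1))]] := compact_bounded vK.
rewrite ltrDl ltr01 => /(_ isT) vM.
apply: ub_le_sup; last by exists x.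
by exists (M + 1) => _ [y Ky <-]; apply: vM; exists y.
Qed.

Lemma cont_space_nrm_ge0 (v : T -> R) : carr (cont_space R K) v ->
  0 <= nrm (cont_space R K) v.
Proof.
(* For an empty [K] the seminorm is the supremum of the empty set, which is 0 by default. *)
move=> cv; have [K0|/set0P[x Kx]] := eqVneq K set0.
  by rewrite /= K0 image_set0 sup0.
by apply: (le_trans _ (cont_space_le_nrm cv Kx)).
Qed.

End cont_space_norm.

(** * Subdifferentiability of the value function under a Slater condition *)

Section perturbation_duality.
Context (R : realType) (T : topologicalType) (K : set T) (H : lmodType R).
Variables (G : set (H * (T -> R))) (J : H -> R).
Hypothesis cK : compact K.
Hypothesis G_scaleD : forall (a : R) h k w z, G (h, w) -> G (k, z) ->
  G (a *: h + k, a *: w + z).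
Hypothesis J_convex : forall (s t : R) h k w z, 0 < s -> 0 < t -> s + t = 1 ->
  G (h, w) -> G (k, z) -> J (s *: h + t *: k) <= s * J h + t * J k.
Hypothesis J_bounded : exists m : R, forall h w, G (h, w) -> m <= J h.
Variables (h0 : H) (w0 : T -> R) (eps : R).
Hypotheses (Gh0 : G (h0, w0)) (eps0 : 0 < eps).
Hypothesis w0_ge : forall x, K x -> eps <= w0 x.

Let CK := cont_space R K.

Let G_scale (a : R) h w : G (h, w) -> G (a *: h, a *: w).
Proof.
move=> Ghw; have G0 := G_scaleD (-1) Ghw Ghw.
rewrite !scaleN1r !addNr in G0.
by have := G_scaleD a Ghw G0; rewrite !addr0.
Qed.

Definition perturbed_values (v : T -> R) : set R :=
  [set j | exists h w, [/\ G (h, w), forall x, K x -> v x <= w x & j = J h]].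

(** For continuous [v] this real infimum is a genuine one, by [has_inf_perturbed_values]. *)
Definition value_function (v : T -> R) : R := inf (perturbed_values v).

(** One multiple of the Slater point serves all [v] below [M]; this uniformity bounds the value
    function above on balls. *)
Lemma perturbed_valuesW (v : T -> R) (M : R) : 0 <= M ->
  (forall x, K x -> v x <= M) -> perturbed_values v (J ((M / eps) *: h0)).
Proof.
move=> M0 vM; exists ((M / eps) *: h0), ((M / eps) *: w0); split => //.
  exact: G_scale.
move=> x Kx; apply: (le_trans (vM _ Kx)).
have epsN0 : eps != 0 by rewrite gt_eqF.
rewrite -[leLHS](divfK epsN0).
by rewrite ler_wpM2l ?w0_ge// divr_ge0// ltW.
Qed.

Lemma has_inf_perturbed_values v : carr CK v -> has_inf (perturbed_values v).
Proof.
move=> cv; split.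
  exists (J ((nrm CK v / eps) *: h0)); apply: perturbed_valuesW.
    exact: cont_space_nrm_ge0.
  by move=> x Kx; apply: (le_trans (ler_norm _)); exact: cont_space_le_nrm.
have [m Jm] := J_bounded; exists m => _ [h [w [Ghw _ ->]]].
exact: Jm Ghw.
Qed.

Lemma value_function_le v h w : carr CK v -> G (h, w) ->
  (forall x, K x -> v x <= w x) -> value_function v <= J h.
Proof.
move=> cv Ghw vw; apply: ge_inf; first by have [] := has_inf_perturbed_values cv.
by exists h, w.
Qed.

Lemma value_function_adherent v e : carr CK v -> 0 < e ->
  exists h w, [/\ G (h, w), forall x, K x -> v x <= w x & J h < value_function v + e].
Proof.
move=> cv e0.
have [_ [h [w [Ghw vw ->]]] Jh] := inf_adherent e0 (has_inf_perturbed_values cv).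
by exists h, w.
Qed.

Let CK0 : carr CK 0.
Proof. by move=> x; exact: cvg_cst. Qed.

Let CK_scale (a : R) u : carr CK u -> carr CK (a *: u).
Proof. by move=> cu; rewrite -[_ *: _]addr0; exact: cont_space_scaleD. Qed.

(** Near-minimizers for [u] and [v] combine, inside the linear graph, to an admissible pair for the
    combination. *)
Lemma value_function_convex (s t : R) u v : 0 < s -> 0 < t -> s + t = 1 ->
  carr CK u -> carr CK v ->
  value_function (s *: u + t *: v) <= s * value_function u + t * value_function v.
Proof.
move=> s0 t0 st1 cu cv; apply/ler_addgt0Pr => e e0.
have [h [w [Ghw uw Jh]]] := value_function_adherent cu e0.
have [k [z [Gkz vz Jk]]] := value_function_adherent cv e0.
have Gst : G (s *: h + t *: k, s *: w + t *: z).
  by apply: G_scaleD => //; exact: G_scale.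
have cst : carr CK (s *: u + t *: v) by apply: cont_space_scaleD => //; exact: CK_scale.
apply: (le_trans (value_function_le cst Gst _)).
  move=> x Kx; apply: lerD; apply: ler_wpM2l; rewrite ?(ltW s0) ?(ltW t0)//.
    exact: uw.
  exact: vz.
apply: (le_trans (J_convex s0 t0 st1 Ghw Gkz)).
have -> : e = s * e + t * e by rewrite -mulrDl st1 mul1r.
rewrite addrACA -!mulrDr; apply: lerD.
  by rewrite ler_pM2l// ltW.
by rewrite ler_pM2l// ltW.
Qed.

(** [f] is a subgradient of the value function at [0]. *)
Lemma perturbation_duality : exists f : (T -> R) -> R, dual CK f /\
  forall h w v, G (h, w) -> carr CK v -> (forall x, K x -> v x <= w x) ->
    value_function 0 <= J h - f v.
Proof.
pose p v := value_function v - value_function 0.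
have p_convex (s t : R) u v : 0 < s -> 0 < t -> s + t = 1 ->
    carr CK u -> carr CK v -> p (s *: u + t *: v) <= s * p u + t * p v.
  move=> s0 t0 st1 cu cv; have := value_function_convex s0 t0 st1 cu cv.
  rewrite /p => h.
  have -> : s * (value_function u - value_function 0) +
    t * (value_function v - value_function 0) =
    s * value_function u + t * value_function v - (s + t) * value_function 0 by ring.
  by rewrite st1 mul1r; lra.
have p0 : 0 <= p 0 by rewrite /p subrr.
have [f [flin fp]] := hahn_banach_convex CK0 (@cont_space_scaleD _ _ K) p_convex p0.
exists f; split; last first.
  move=> h w v Ghw cv vw; have := fp _ cv; have := value_function_le cv Ghw vw.
  by rewrite /p; lra.
have f0 : f 0 = 0.
  by have := flin (-1) _ _ CK0 CK0; rewrite scaler0 addr0 mulN1r addNr.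
have fZ (a : R) u : carr CK u -> f (a *: u) = a * f u.
  by move=> cu; have := flin a _ _ cu CK0; rewrite f0 !addr0.
split => //.
(* The Slater multiple for [M] = 1 bounds [f] on the unit ball. *)
pose D := J ((1 / eps) *: h0) - value_function 0.
have D_ge v : carr CK v -> (forall x, K x -> `|v x| <= 1) -> f v <= D.
  move=> cv v1; apply: (le_trans (fp _ cv)); rewrite lerD2r.
  apply: ge_inf; first by have [] := has_inf_perturbed_values cv.
  apply: perturbed_valuesW => // x Kx; exact: (le_trans (ler_norm _) (v1 _ Kx)).
have D0 : 0 <= D.
  by rewrite -f0; apply: D_ge => // x Kx; rewrite normr0.
have fD v : carr CK v -> f v <= D * nrm CK v.
  move=> cv; have n0 := cont_space_nrm_ge0 cK cv.
  apply/ler_addgt0Pr => e e0.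
  (* The seminorm of [v] may vanish, so [v] is divided by a slightly larger number; the excess costs
     D e/(D+1), at most [e]. *)
  pose n := nrm CK v + e / (D + 1).
  have D1 : 0 < D + 1 by lra.
  have eD : 0 < e / (D + 1) by rewrite divr_gt0.
  have ngt0 : 0 < n by rewrite /n; lra.
  have : f (n^-1 *: v) <= D.
    apply: D_ge; first exact: CK_scale.
    move=> x Kx; rewrite (_ : (n^-1 *: v) x = v x / n); last by rewrite mulrC.
    rewrite normrM normfV (gtr0_norm ngt0) ler_pdivrMr// mul1r; apply: (le_trans (cont_space_le_nrm cK cv Kx)).
    by rewrite /n lerDl ltW.
  rewrite fZ// mulrC ler_pdivrMr// => /le_trans; apply.
  rewrite /n mulrDr lerD2l mulrA ler_pdivrMr// mulrC ler_pM2l//; lra.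
exists D => v cv; rewrite ler_norml fD// andbT.
(* The lower bound is the upper bound at [- v], which has the same seminorm. *)
have Nv := fD _ (@CK_scale (-1) _ cv); rewrite fZ// mulN1r in Nv.
rewrite lerNl; apply: (le_trans Nv).
rewrite ler_wpM2l// le_eqVlt; apply/orP; left; apply/eqP.
rewrite scaleN1r /=; congr sup; apply/seteqP.
by split => _ [x Kx <-]; exists x => //; rewrite /= normrN.
Qed.

End perturbation_duality.

(** * The functional Phi *)

Lemma Rintegral_eq0 (R : realType) disp (T : measurableType disp)
  (mu : {measure set T -> \bar R}) (D : set T) (f : T -> R) :
  (forall x, f x = 0) -> \int[mu]_(x in D) f x = 0.
Proof.
move=> f0; rewrite /Rintegral (eq_integral (cst 0%E)) ?integral0//.
by move=> x _; rewrite /= f0.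
Qed.

Section Phi_theory.
Context (R : realType) (d : nat) (Om : set 'rV[R]_d).
Variables (aij : 'I_d -> 'I_d -> 'rV[R]_d -> R) (c r : 'rV[R]_d -> R).
Variables (q' : R) (omc omo : set 'rV[R]_d).
Variables (muo : {measure set (borel_rV R d) -> \bar R}).
Variables (E : set (sobfun R d * ('rV[R]_d -> R))) (yd : 'rV[R]_d -> R).

Local Notation S := (S_graph Om aij c r q' omc omo muo E).
Local Notation Phi := (Phi Om aij c r q' omc omo muo E yd).
Local Notation L2 := (L2_obs omo muo).

Definition tracking (h : 'rV[R]_d -> R) : R :=
  2^-1 * nrm L2 (h + yd) ^+ 2 - 2^-1 * nrm L2 yd ^+ 2.

Lemma S_graph_dom h w : S (h, w) ->
  dom_S Om q' omo muo E h /\ carr (cont_space R omc) w.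
Proof. by move=> [phi [[f [Ehf _]] [_ cw _]]]; split => //; exists f. Qed.

Lemma dom_S_carr h : dom_S Om q' omo muo E h -> carr L2 h.
Proof. by move=> [f []]. Qed.

(** Indicators are non-negative, so a single representative [w] with [w - v] in the cone makes the
    infimum over all representatives equal to 0. *)
Lemma Phi_feasible h v w : S (h, w) -> nonneg_cone omc (w - v) ->
  Phi (h, v) = (tracking h)%:E.
Proof.
move=> Shw Cwv; have [domh _] := S_graph_dom Shw.
rewrite /Phi /indicator (asboolT domh) adde0.
rewrite (_ : ereal_inf _ = 0%E) ?adde0//; apply/eqP; rewrite eq_le; apply/andP; split.
  by apply: ereal_inf_lbound; exists w => //; rewrite asboolT.
by apply: le_ereal_inf_tmp => _ [z _ <-]; case: asboolP.
Qed.

(** This includes the case where no [p] in the domain of *A solves the adjoint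
    equation for [h], so the surjectivity of *A plays no role. *)
Lemma Phi_infeasible h v :
  ~ (exists w, S (h, w) /\ nonneg_cone omc (w - v)) -> Phi (h, v) = +oo%E.
Proof.
move=> nSC; rewrite /Phi; set inf_ := ereal_inf _.
have -> : inf_ = +oo%E.
  apply/eqP; rewrite -leye_eq; apply: le_ereal_inf_tmp => _ [z Shz <-].
  rewrite /indicator; case: asboolP => // Cz.
  by exfalso; apply: nSC; exists z.
by rewrite addeC /indicator; case: asboolP => _; rewrite ?add0e ?addye// addey.
Qed.

Let p2 : (1 <= 2%:E :> \bar R)%E. Proof. by rewrite lee_fin ler1n. Qed.

Lemma tracking_convex (s t : R) h k : carr L2 yd -> 0 < s -> 0 < t -> s + t = 1 ->
  carr L2 h -> carr L2 k -> tracking (s *: h + t *: k) <= s * tracking h + t * tracking k.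
Proof.
move=> Lyd s0 t0 st1 Lh Lk; rewrite /tracking.
have LD (u : 'rV[R]_d -> R) : carr L2 u -> carr L2 (u + yd).
  by move=> Lu; rewrite -[u]scale1r; exact: (Lspace_scaleD 1 p2 Lu Lyd).
have [Lhy Lky] := (LD _ Lh, LD _ Lk).
set a := nrm L2 (h + yd); set b := nrm L2 (k + yd).
set n := nrm L2 (_ + _ + _); set m := 2^-1 * nrm L2 yd ^+ 2.
have a0 : 0 <= a by exact: Lspace_nrm_ge0.
have b0 : 0 <= b by exact: Lspace_nrm_ge0.
have n0 : 0 <= n by exact: Lspace_nrm_ge0.
have nab : n <= s * a + t * b.
  (* As the weights sum to 1, [yd] is distributed over both terms. *)
  rewrite /n (_ : s *: h + t *: k + yd = s *: (h + yd) + t *: (k + yd)); last first.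
    by rewrite !scalerDr addrACA -scalerDl st1 scale1r.
  have Ltk : carr L2 (t *: (k + yd)).
    have := Lspace_scaleD t p2 Lky (Lspace0 muo omo p2).
    by rewrite addr0.
  apply: (le_trans (Lspace_nrm_scaleD s p2 Lhy Ltk)).
  rewrite (gtr0_norm s0) lerD2l -[X in X * b](gtr0_norm t0).
  exact: (Lspace_nrmZ t p2 Lky).
have n2 : n ^+ 2 <= (s * a + t * b) ^+ 2.
  by rewrite ler_pXn2r// nnegrE addr_ge0// mulr_ge0// ltW.
have : (s * a + t * b) ^+ 2 <= s * a ^+ 2 + t * b ^+ 2.
  (* Convexity of the square, with its exact defect. *)
  rewrite -subr_ge0 (_ : _ - _ = s * t * (a - b) ^+ 2).
    exact: (mulr_ge0 (mulr_ge0 (ltW s0) (ltW t0)) (sqr_ge0 _)).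
  by rewrite (_ : t = 1 - s); [ring|lra].
move=> /(le_trans n2) nab2.
have -> : s * (2^-1 * a ^+ 2 - m) + t * (2^-1 * b ^+ 2 - m) =
    2^-1 * (s * a ^+ 2 + t * b ^+ 2) - (s + t) * m by ring.
by rewrite st1 mul1r lerD2r ler_wpM2l.
Qed.

Lemma tracking_ge h : - (2^-1 * nrm L2 yd ^+ 2) <= tracking h.
Proof. by rewrite /tracking -[leLHS]add0r lerD2r mulr_ge0 ?sqr_ge0. Qed.

End Phi_theory.

Theorem proposition4p3 (R : realType) (d : nat) (hd : (0 < d)%N)
  (Om : set 'rV[R]_d) (hOm : bounded_lipschitz_domain Om)
  (aij : 'I_d -> 'I_d -> 'rV[R]_d -> R) (a0 : R)
  (haij : elliptic_coefficients Om aij a0)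
  (c r : 'rV[R]_d -> R) (hcr : lower_order_coefficients Om c r)
  (q q' : R) (hq : d%:R < q) (hqq' : q^-1 + q'^-1 = 1) (hq' : q' <= 2)
  (hdomA : forall p, dom_A Om aij c r q' p -> exists phi, cont_repr Om p phi)
  (omc : set 'rV[R]_d) (homc : compact omc) (homcOm : omc `<=` closure Om)
  (omo : set 'rV[R]_d) (homo : measurable (omo : set (borel_rV R d)))
  (homoOm : omo `<=` closure Om)
  (muo : {measure set (borel_rV R d) -> \bar R})
  (E : set (sobfun R d * ('rV[R]_d -> R)))
  (hE : observation_operator Om q' omo muo E)
  (yd : 'rV[R]_d -> R) (hyd : carr (L2_obs omo muo) yd)
  (slater : exists h w eps,
    [/\ dom_S Om q' omo muo E h,
        S_graph Om aij c r q' omc omo muo E (h, w),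
        0 < eps & forall x, omc x -> eps <= w x]) :
  ereal_inf [set Phi Om aij c r q' omc omo muo E yd (h, 0) |
             h in carr (L2_obs omo muo)] =
  ereal_sup [set (- Phi_conj Om aij c r q' omc omo muo E yd (0%R, v'))%E |
             v' in radon omc].
Proof.
have [oOm _ _ bOm _] := hOm.
have [Laij _ _ _] := haij.
have [Lc _ Lr _ _] := hcr.
have [lE _ _ _] := hE.
have [h0 [w0 [eps [domh0 Sh0 eps0 w0eps]]]] := slater.
set S := S_graph Om aij c r q' omc omo muo E in Sh0 *.
set J := tracking omo muo yd.
have SD (a : R) h k w z : S (h, w) -> S (k, z) -> S (a *: h + k, a *: w + z).
  exact: S_graph_scaleD.
have SL h w : S (h, w) -> carr (L2_obs omo muo) h.
  by move=> /S_graph_dom [/dom_S_carr].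
have Scont h w : S (h, w) -> carr (cont_space R omc) w.
  by move=> /S_graph_dom [].
have Jconv (s t : R) h k w z : 0 < s -> 0 < t -> s + t = 1 ->
    S (h, w) -> S (k, z) -> J (s *: h + t *: k) <= s * J h + t * J k.
  move=> s0 t0 st1 /SL Lh /SL Lk; exact: tracking_convex.
have Jbnd : exists m : R, forall h w, S (h, w) -> m <= J h.
  by exists (- (2^-1 * nrm (L2_obs omo muo) yd ^+ 2)) => h w _; exact: tracking_ge.
have c0 : carr (cont_space R omc) 0 by move=> x; exact: cvg_cst.
have inner0 h : inner_obs omo muo 0 h = 0.
  by apply: Rintegral_eq0 => x; rewrite mul0r.
apply/eqP; rewrite eq_le; apply/andP; split; last first.
  (* Weak duality: [(h, 0)] competes in the supremum defining the conjugate, and both pairings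
     vanish there. *)
  apply: ge_ereal_sup => _ [v' [v'lin _] <-].
  apply: le_ereal_inf_tmp => _ [h Lh <-].
  have v'0 : v' 0 = 0.
    by have := v'lin (-1) _ _ c0 c0; rewrite scaler0 addr0 mulN1r addNr.
  rewrite leeNl; apply: ereal_sup_ubound; exists (h, 0) => //=.
  by rewrite inner0 v'0 addr0 add0e.
have [f [df fP]] := perturbation_duality homc SD Jconv Jbnd Sh0 eps0 w0eps.
set nu0 := value_function _ _ _ 0 in fP.
apply: (@le_trans _ _ nu0%:E).
  (* A near-minimizer for the value function at 0 is feasible for [Phi] at [v] = 0, where [Phi]
     equals [J]. *)
  apply/lee_addgt0Pr => e e0.
  have [h [w [Shw w0_ Jh]]] := value_function_adherent homc SD Jbnd Sh0 eps0 w0eps c0 e0.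
  apply: (@le_trans _ _ (J h)%:E); last by rewrite -EFinD lee_fin ltW.
  apply: ereal_inf_lbound; exists h; first exact: SL Shw.
  apply: (Phi_feasible yd Shw); rewrite subr0; split => //; exact: Scont Shw.
apply: (@le_trans _ _ (- Phi_conj Om aij c r q' omc omo muo E yd (0%R, f))%E); last first.
  by apply: ereal_sup_ubound; exists f.
(* Every term of the conjugate at [f] is at most [- nu0]: by the subgradient inequality on feasible
   pairs, and because it is minus infinity on the others. *)
rewrite leeNr; apply: ge_ereal_sup => _ [[h v] /= [Lh cv] <-].
have [[w [Shw [cwv wv]]]|nS] := pselect (exists w, S (h, w) /\ nonneg_cone omc (w - v)).
  rewrite (Phi_feasible yd Shw (conj cwv wv)) inner0 add0r.
  rewrite -EFinB lee_fin.
  have vw x : omc x -> v x <= w x by move=> /wv; rewrite /= subr_ge0.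
  have := fP _ _ _ Shw cv vw; rewrite -/J; lra.
by rewrite (Phi_infeasible yd nS) /= leNye.
Qed.
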